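(* Let $k\ge 4$ and let $\theta\in\mathcal P^k_{\mathrm{lam}}\setminus\mathcal P^k_{\mathrm s}$, i.e. $\theta$ is a probability distribution on the bipartitions of $[k]$ whose support is laminar and which is not supported only on singleton bipartitions. Then there exists a $k$-tensor $\psi$ such that $$E_\theta(\psi)<E^\theta(\psi).$$
   Context: **Tensors and bipartitions.** $[k]=\{1,\dots,k\}$. A $k$-tensor is an element $\psi$ of $V=V_1\otimes\cdots\otimes V_k$ with $V_i=\mathbb C^{d_i}$ equipped with its standard inner product; $V_S=\bigotimes_{i\in S}V_i$ for $S\subseteq[k]$. A bipartition of $[k]$ is an unordered pair $b=\{S,\overline S\}$ (also written $S|\overline S$, or just $S$) with $\emptyset\ne S\subsetneq[k]$ and $\overline S=[k]\setminus S$. It is a singleton bipartition if $S$ or $\overline S$ has one element. Two bipartitions $\{S,\overline S\}$, $\{T,\overline T\}$ are mutually laminar if there are $A\in\{S,\overline S\}$, $B\in\{T,\overline T\}$ with $A\subseteq B$; a set of bipartitions is laminar if every pair of its members is mutually laminar. $\mathcal P^k$ is the set of probability distributions $\theta$ on the set of bipartitions of $[k]$ (with weights $\theta(b)=\theta_b$); $\mathcal P^k_{\mathrm{lam}}\subseteq\mathcal P^k$ consists of those with laminar support, and $\mathcal P^k_{\mathrm s}\subseteq\mathcal P^k$ of those supported only on singleton bipartitions. **Entropies.** $H$ denotes Shannon entropy (base-2 logarithm) of a probability vector, or the Shannon entropy of the eigenvalues of a positive semidefinite trace-one operator. For $\psi\neq0$ and $b=\{S,\overline S\}$, let $\psi_S:V_{\overline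 S}^*\to V_S$ be the flattening of $\psi$, $\rho_S=\psi_S\psi_S^*/\|\psi\|_2^2$, and $H_b(\psi)=H_S(\psi)=H(\rho_S)$ (independent of the chosen side). $H_\theta(\psi)=\sum_b\theta(b)H_b(\psi)$. **Lower quantum functional** (for $\theta\in\mathcal P^k$): $E_\theta(\psi)=\sup_{A_j\in \mathrm{GL}(V_j)}H_\theta((A_1\otimes\cdots\otimes A_k)\psi)$ for $\psi\ne0$, $E_\theta(0)=-\infty$, and $F_\theta=2^{E_\theta}$. **Upper quantum functional** (for $\theta\in\mathcal P^k_{\mathrm{lam}}$): For $n\ge1$ and a partition $\lambda\vdash n$, let $P_\lambda^{V_S}$ be the projector on $V^{\otimes n}\cong V_S^{\otimes n}\otimes V_{\overline S}^{\otimes n}$ onto the $\lambda$-isotypic component of the symmetric group $S_n$ acting by permuting the $n$ tensor factors of $V_S^{\otimes n}$ (and trivially on $V_{\overline S}^{\otimes n}$). Let $P_{(n)}^{V_{[k]}}$ be the projector onto the symmetric subspace of $V^{\otimes n}$, and set $P_\lambda^{V_b}=P_\lambda^{V_S}P_{(n)}^{V_{[k]}}$ for $b=\{S,\overline S\}$ (independent of the chosen side). For mutually laminar bipartitions these operators commute. Define $$E^\theta(\psi)=\sup_{n\ge1}\ \sup_{(\lambda^{(b)})_b}\ \sum_{b\in\mathrm{supp}\,\theta}\theta(b)\,H\big(\lambda^{(b)}/n\big),$$ the inner supremum being over tuples of partitions $\lambda^{(b)}\vdash n$, $b\in\mathrm{supp}\,\theta$, with $\big(\prod_{b\in\mathrm{supp}\,\theta}P^{V_b}_{\lambda^{(b)}}\big)\psi^{\otimes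 n}\ne0$; and $F^\theta=2^{E^\theta}$, with $E^\theta(0)=-\infty$, $F^\theta(0)=0$. *)

(* Defs.v *)
From HB Require Import structures.
From mathcomp Require Import all_boot all_order all_algebra all_fingroup.
From mathcomp Require Import spectral sesquilinear mxrepresentation.
From mathcomp Require Import complex.
From mathcomp Require Import all_classical all_reals ereal exp.

Set Implicit Arguments.
Unset Strict Implicit.
Unset Printing Implicit Defensive.

Import Order.TTheory GRing.Theory Num.Theory.
Local Open Scope ring_scope.
Local Open Scope complex_scope.
Local Open Scope sesquilinear_scope.
Local Open Scope classical_set_scope.

Definition is_bipart k (b : {set {set 'I_k}}) : bool :=
  [exists S : {set 'I_k}, [&& S != finset.set0, S != finset.setT
                            & b == [set S; ~: S]%SET]].

Definition bipart k := {b : {set {set 'I_k}} | is_bipart b}.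

(* A side of b. The quantities defined from it below do not depend on which
   of the two sides is picked. *)
Definition side k (b : bipart k) : {set 'I_k} :=
  odflt finset.set0 [pick S in val b].

Lemma side_in k (b : bipart k) : side b \in val b.
Proof.
rewrite /side; case: pickP => //= nob.
have /existsP[S /and3P[_ _ /eqP bE]] := valP b.
by have := nob S; rewrite /= bE !inE eqxx.
Qed.

Definition singleton_bipart k (b : bipart k) : bool :=
  [exists S in val b, #|S| == 1%N].

Definition laminar k (b c : bipart k) : bool :=
  [exists A in val b, exists B in val c, A \subset B].

Section Distributions.
Variables (R : realType) (k : nat).

Definition dists : set (bipart k -> R) :=
  [set theta | (forall b, 0 <= theta b) /\ \sum_b theta b = 1].

Definition lam_dists : set (bipart k -> R) :=
  [set theta | dists theta /\
    forall b c, theta b != 0 -> theta c != 0 -> laminar b c].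

Definition sing_dists : set (bipart k -> R) :=
  [set theta | dists theta /\ forall b, theta b != 0 -> singleton_bipart b].

End Distributions.

(* [ln 0 = 0] in the library, so that null entries contribute 0. *)
Definition shannon (R : realType) (p : seq R) : R :=
  - \sum_(x <- p) x * (ln x / ln 2).

(* Meant for positive semidefinite matrices, whose eigenvalues are real. *)
Definition vn_entropy (R : realType) n (rho : 'M[R[i]]_n) : R :=
  shannon [seq complex.Re (spectral_diag rho 0 i) | i : 'I_n].

(* Tensors are given by their coordinates in the product basis. *)
Definition idx k (d : 'I_k -> nat) := {dffun forall i : 'I_k, 'I_(d i)}.

Definition tensor (R : realType) k (d : 'I_k -> nat) :=
  {ffun idx d -> R[i]}.

Definition sub_idx k (d : 'I_k -> nat) (S : {set 'I_k}) :=
  {dffun forall i : {i : 'I_k | i \in S}, 'I_(d (val i))}.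

Lemma notin_setC (T : finType) (S : {set T}) i : i \notin S -> i \in (~: S)%SET.
Proof. by rewrite !inE. Qed.

Definition merge k (d : 'I_k -> nat) (S : {set 'I_k})
    (a : sub_idx d S) (b : sub_idx d (~: S)%SET) : idx d :=
  [ffun i => match @boolP (i \in S) with
             | AltTrue iS => a (exist _ i iS)
             | AltFalse iS => b (exist _ i (notin_setC iS))
             end].

Section Functionals.
Variables (R : realType) (k : nat) (d : 'I_k -> nat).
Implicit Types (S : {set 'I_k}) (psi : tensor R d) (theta : bipart k -> R).

Definition flattening S psi :
    'M[R[i]]_(#|{: sub_idx d S}|, #|{: sub_idx d (~: S)%SET}|) :=
  \matrix_(a, b) psi (merge (enum_val a) (enum_val b)).

Definition density S psi : 'M[R[i]]_(#|{: sub_idx d S}|) :=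
  (\sum_x `|psi x| ^+ 2)^-1 *: (flattening S psi *m (flattening S psi)^t*).

Definition bip_entropy psi (b : bipart k) : R :=
  vn_entropy (density (side b) psi).

Definition dist_entropy theta psi : R :=
  \sum_b theta b * bip_entropy psi b.

(* (A_1 (x) ... (x) A_k) psi *)
Definition tensor_app (A : forall i, 'M[R[i]]_(d i)) psi : tensor R d :=
  [ffun x : idx d => \sum_(y : idx d) (\prod_i A i (x i) (y i)) * psi y].

Definition E_lower theta psi : \bar R :=
  if psi == 0 then -oo%E else
  ereal_sup [set (dist_entropy theta (tensor_app A psi))%:E
    | A in [set A : forall i, 'M[R[i]]_(d i) | forall i, A i \in unitmx]].

End Functionals.

Definition is_intpart (n : nat) (la : seq nat) : bool :=
  [&& sorted geq la, 0%N \notin la & sumn la == n].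

Section Specht.
Variables (C : numClosedFieldType) (n : nat).
Local Notation G := [set: 'S_n]%G.

(* The stabilisers of the rows and of the columns of the tableau of shape [la]
   filled with 0, ..., n-1 in reading order. *)
Definition row_stab (la : seq nat) : {set 'S_n} :=
  [set s : 'S_n | [forall i, reshape_index la (s i) == reshape_index la i]]%SET.

Definition col_stab (la : seq nat) : {set 'S_n} :=
  [set s : 'S_n | [forall i, reshape_offset la (s i) == reshape_offset la i]]%SET.

(* The Young symmetriser, as a row vector of the regular representation. *)
Definition young_sym (la : seq nat) : 'rV[C]_#|G| :=
  gring_row (\sum_(p in row_stab la) \sum_(q in col_stab la)
               (-1) ^+ q *: regular_repr C G (p * q)%g).

Definition specht (la : seq nat) :=
  submod_repr (cyclic_mx_module (regular_repr C G) (young_sym la)).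

End Specht.

Section TensorPower.
Variables (k : nat) (d : 'I_k -> nat) (n : nat).

Definition pow_idx := {ffun 'I_n -> idx d}.

(* Right action of 'S_n : the product s * t of mathcomp is "s, then t". *)
Definition perm_idx (S : {set 'I_k}) (s : 'S_n) (X : pow_idx) : pow_idx :=
  [ffun j => [ffun i => if i \in S then X ((s^-1)%g j) i else X j i] : idx d].

Lemma perm_idx1 S X : perm_idx S 1%g X = X.
Proof.
apply/ffunP => j; apply/ffunP => i.
by rewrite !ffunE invg1 perm1; case: ifP.
Qed.

Lemma perm_idxM S s t X :
  perm_idx S (s * t)%g X = perm_idx S t (perm_idx S s X).
Proof.
apply/ffunP => j; apply/ffunP => i.
by rewrite !ffunE; case: ifP => iS; rewrite ?ffunE ?iS // invMg permM.
Qed.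

Variable C : numClosedFieldType.

Definition perm_idx_mx (S : {set 'I_k}) (s : 'S_n) : 'M[C]_#|{: pow_idx}| :=
  \matrix_(a, b) (perm_idx S s (enum_val a) == enum_val b)%:R.

Lemma perm_idx_mx_repr S : mx_repr [set: 'S_n]%G (perm_idx_mx S).
Proof.
split=> [|s t _ _]; apply/matrixP => a b; rewrite !mxE.
  by rewrite perm_idx1 (inj_eq enum_val_inj).
rewrite (bigD1 (enum_rank (perm_idx S s (enum_val a)))) //= !mxE enum_rankK.
rewrite eqxx mul1r -perm_idxM big1 ?addr0 // => c cN; rewrite !mxE.
case: eqP => [e|_]; last by rewrite mul0r.
by rewrite e enum_valK eqxx in cN.
Qed.

Definition perm_repr (S : {set 'I_k}) :=
  MxRepresentation (perm_idx_mx_repr S).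

(* Matrices act on row vectors from the right, subspaces are row spaces. *)
Definition isotypic (S : {set 'I_k}) (la : seq nat) : 'M[C]_#|{: pow_idx}| :=
  (\sum_(W : DecSocleType (perm_repr S)
        | `[< mx_rsim (socle_repr W) (specht C n la) >]) W)%MS.

(* The isotypic components of a unitary representation are orthogonal. *)
Definition isoproj S la : 'M[C]_#|{: pow_idx}| := proj_ortho (isotypic S la).

Definition symproj : 'M[C]_#|{: pow_idx}| :=
  proj_ortho (rfix_mx (perm_repr finset.setT) [set: 'S_n]%G).

Definition bip_proj (b : bipart k) (la : seq nat) : 'M[C]_#|{: pow_idx}| :=
  symproj *m isoproj (side b) la.

End TensorPower.

Section UpperFunctional.
Variables (R : realType) (k : nat) (d : 'I_k -> nat).
Implicit Types (psi : tensor R d) (theta : bipart k -> R).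

Definition tensor_pow n psi : 'rV[R[i]]_#|{: pow_idx d n}| :=
  \row_X \prod_(j < n) psi ((enum_val X : pow_idx d n) j).

(* For laminar [theta] the factors of the product commute. *)
Definition admissible theta psi n (la : bipart k -> seq nat) : Prop :=
  (forall b, theta b != 0 -> is_intpart n (la b)) /\
  tensor_pow n psi *m
    (\big[mulmx/1%:M]_(b | theta b != 0) bip_proj d n R[i] b (la b)) != 0.

Definition part_entropy n (la : seq nat) : R :=
  shannon [seq (m%:R / n%:R : R) | m <- la].

Definition E_upper theta psi : \bar R :=
  if psi == 0 then -oo%E else
  ereal_sup [set ereal_sup
      [set (\sum_(b | theta b != 0) theta b * part_entropy n (la b))%:E
        | la in [set la | admissible theta psi n la]]
    | n in [set n | (1 <= n)%N]].

End UpperFunctional.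

(* Main.v *)
Require Import Defs.
From HB Require Import structures.
From mathcomp Require Import all_boot all_order all_algebra all_fingroup.
From mathcomp Require Import spectral sesquilinear mxrepresentation.
From mathcomp Require Import complex.
From mathcomp Require Import all_classical all_reals ereal exp.
From mathcomp Require Import ring lra.

(** Why the two functionals differ.  Choose [b0] in the support of [theta] with
    at least two parties on each side, two parties [p1, p2] on one side and
    [p3, p4] on the other, and give these four parties a qubit each and all the
    others a space of dimension 1.  By laminarity every bipartition of the
    support meets the four parties trivially, in a singleton, or as
    [p1 p2 | p3 p4].  Entropies of flattenings are therefore at most 0, 1 and 2
    respectively ([four_height]); the witness tensor reaches all these maxima
    for the upper functional, and misses the one of [b0] for the lower one by a
    fixed amount.

    Upper functional. Four copies suffice. On four copies of four qubits there
    is the vector [vol_vec] = vol(V_p1 (x) V_p2) (x) vol(V_p3 (x) V_p4), the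
    pairing with which is, up to a factor, the determinant of the 4 x 4
    flattening. It is fixed by the symmetric group. Under the group acting on
    the tensor factors of one side only it is alternating if that side is {p1,
    p2}, and if it is a singleton (or the complement of one) it lies in the
    isotypic component of the partition (2, 2), because it is invariant under
    SL_2 of that party and the sign twist preserves (2, 2) ([vol_vec_isotypic]).
    The entropies of (4), (2, 2), (1, 1, 1, 1) are exactly 0, 1, 2. As [vol_vec]
    lies in the range of every projector involved, the projected fourth power of
    a tensor pairs with it like the power itself, hence is nonzero as soon as
    the flattening [p1 p2 | p3 p4] is invertible ([E_upper_witness]).

    Membership in an isotypic component is tested on transpositions: a family of
    vectors on which the transpositions (0 i) act by the same irreducible
    matrices as on the Young symmetriser spans a copy of the Specht module
    ([intertwiner_sub_isotypic]).  For (2, 2) these matrices come from the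
    Garnir relation ([garnir_relation], [young_sym22_garnir]).

    Lower functional.  The form alt (x) alt (x) alt (x) alt, with alt the
    determinant form of C^2, gives a quadratic invariant [quad_inv] that is
    multiplied by delta = prod_i det A_i under A_1 (x) ... (x) A_4, while the
    determinant of the 4 x 4 flattening is multiplied by delta ^ 2.  So the
    ratio |det| / |quad_inv| ^ 2 is constant on the orbit, and
    |quad_inv| <= |psi| ^ 2 ([quad_inv_le]).  For the witness, whose flattening
    is diag(w, 1, 1, 1) with w = 16 ^ 2, this ratio is so small that the product
    of the four eigenvalues of the density operator never exceeds 16 ^ -4, which
    keeps the entropy below a constant smaller than 2 ([entropy_gap],
    [side_entropy_gap], [E_lower_witness]). *)

Set Implicit Arguments.
Unset Strict Implicit.
Unset Printing Implicit Defensive.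
Import Order.TTheory GRing.Theory Num.Theory.
Local Open Scope ring_scope.

(** * Intertwiners given on generators *)

Section Models.
Variables (F : fieldType) (gT : finGroupType) (G : {group gT}) (I : finType) (g : I -> gT).
Hypothesis gen_g : <<[set g i | i in I]>>%g = G.
Variables (d : nat) (M : I -> 'M[F]_d).

(** Only the matrices of a generating family are recorded, so that a module is
    recognised without writing down the action of every group element. *)
Definition generator_irreducible :=
  forall U : 'M[F]_d, (forall i, (U *m M i <= U)%MS) ->
  U != 0 -> row_full U.

Definition intertwines n (rG : mx_representation F G n) (Y : 'M[F]_(d, n)) :=
  forall i, Y *m rG (g i) = M i *m Y.

Hypothesis irrM : generator_irreducible.

Lemma generator_in i : g i \in G.
Proof. by rewrite -gen_g mem_gen // imset_f. Qed.

Section One.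
Variables (n : nat) (rG : mx_representation F G n) (Y : 'M[F]_(d, n)).
Hypotheses (iY : intertwines rG Y) (nzY : Y != 0).

(** The kernel of [Y] is stable under the model matrices. *)
Lemma intertwiner_free : row_free Y.
Proof.
rewrite -kermx_eq0; apply: contraNT nzY => nzK.
suff fK : row_full (kermx Y).
  have [B BK] := row_fullP fK.
  by rewrite -[Y]mul1mx -BK -mulmxA mulmx_ker mulmx0.
apply: irrM => // i; apply/sub_kermxP.
by rewrite -mulmxA -iY mulmxA mulmx_ker mul0mx.
Qed.

Lemma intertwiner_module : mxmodule rG Y.
Proof.
rewrite /mxmodule -{1}gen_g gen_subG; apply/fintype.subsetP => _ /imsetP[i _ ->].
by rewrite inE generator_in //= iY submxMl.
Qed.

(** [Y] identifies its row space with the model, so a submodule pulls back to a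
    stable subspace. *)
Lemma intertwiner_simple : mxsimple rG <<Y>>%MS.
Proof.
have fY := intertwiner_free.
split; first by rewrite (eqmx_module _ (genmxE _)) intertwiner_module.
  by rewrite -submx0 genmxE submx0.
move=> U modU; rewrite genmxE => sUY nzU; rewrite genmxE.
have UE : U *m pinvmx Y *m Y = U by rewrite mulmxKpV.
have WE : (<<U *m pinvmx Y>> *m Y :=: U)%MS.
  by apply: eqmx_trans (eqmxMr _ (genmxE _)) _; rewrite UE.
suff fW : row_full <<U *m pinvmx Y>>%MS.
  by rewrite -WE -{1}[Y]mul1mx submxMr ?sub1mx.
apply: irrM => [i|].
  rewrite -(submxMfree _ _ fY) -mulmxA -iY mulmxA.
  rewrite (eqmxMr _ WE) WE; apply: (mxmoduleP modU).
  exact: generator_in.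
by apply: contraNneq nzU => W0; rewrite -submx0 -WE W0 mul0mx sub0mx.
Qed.
End One.

(** Schur's lemma in the form used below: two nonzero copies of the same
    irreducible model are isomorphic, through the map sending [Y1] to [Y2]. *)
Lemma intertwiners_rsim n1 n2 (rG1 : mx_representation F G n1)
    (rG2 : mx_representation F G n2) (Y1 : 'M_(d, n1)) (Y2 : 'M_(d, n2))
    (U1 : 'M_n1) (U2 : 'M_n2)
    (modU1 : mxmodule rG1 U1) (modU2 : mxmodule rG2 U2) :
  intertwines rG1 Y1 -> intertwines rG2 Y2 -> Y1 != 0 -> Y2 != 0 ->
  (U1 :=: Y1)%MS -> (U2 :=: Y2)%MS ->
  mx_rsim (submod_repr modU1) (submod_repr modU2).
Proof.
move=> iY1 iY2 nzY1 nzY2 eU1 eU2.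
have fY1 := intertwiner_free iY1 nzY1.
have fY2 := intertwiner_free iY2 nzY2.
have [phi Yphi] : exists phi, Y1 *m phi = Y2.
  by exists (pinvmx Y1 *m Y2); rewrite mulmxA mulmxVp // mul1mx.
have Gphi x : x \in G -> Y1 *m rG1 x *m phi = Y2 *m rG2 x.
  suff : G \subset [set x in G | Y1 *m rG1 x *m phi == Y2 *m rG2 x].
    by move/fintype.subsetP=> s /s; rewrite inE => /andP[_ /eqP].
  have gS : group_set [set x in G | Y1 *m rG1 x *m phi == Y2 *m rG2 x].
    apply/group_setP; split; first by rewrite inE group1 /= !repr_mx1 !mulmx1 Yphi.
    move=> u v; rewrite !inE => /andP[uG /eqP ex] /andP[vG /eqP ey].
    rewrite groupM //= !repr_mxM // !mulmxA.
    have := mxmoduleP (intertwiner_module iY1) u uG; case/submxP => A eA.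
    rewrite -ex eA -(mulmxA A Y1 phi) Yphi.
    have -> : A *m Y1 *m rG1 v *m phi = A *m (Y1 *m rG1 v *m phi).
      by rewrite !mulmxA.
    by rewrite ey mulmxA.
  rewrite -{1}gen_g (_ : [set x in G | _] = Group gS) // gen_subG.
  apply/fintype.subsetP => _ /imsetP[i _ ->]; rewrite inE generator_in //=.
  by rewrite iY1 -mulmxA Yphi iY2.
have r1 : \rank U1 = d by rewrite eU1; apply/eqP.
have r2 : \rank U2 = d by rewrite eU2; apply/eqP.
have sphi m (W : 'M_(m, n1)) : (W <= U1)%MS -> (W *m phi <= U2)%MS.
  by rewrite eU1 => /submxP[D ->]; rewrite -mulmxA Yphi eU2 submxMl.
exists (in_submod U2 (val_submod (1%:M : 'M_(\rank U1)) *m phi)).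
- by rewrite r1 r2.
- rewrite /row_free mxrank_in_submod ?sphi ?val_submodP //.
  rewrite (eqmxMr _ (val_submod1 _)) (eqmxMr _ eU1) Yphi.
  by rewrite r1; apply/eqP/eqP.
move=> x xG; rewrite -in_submodJ ?sphi ?val_submodP //.
have -> : submod_repr modU1 x *m in_submod U2 (val_submod 1%:M *m phi)
   = in_submod U2 (val_submod (1%:M *m submod_repr modU1 x) *m phi).
  by rewrite mul1mx in_submodE mulmxA -in_submodE (mulmxA _ _ phi) -val_submodE.
rewrite val_submodJ //; congr in_submod.
have : (val_submod (1%:M : 'M_(\rank U1)) <= Y1)%MS by rewrite -eU1 val_submodP.
by case/submxP => D ->; rewrite -!mulmxA (mulmxA Y1) Gphi // (mulmxA Y1) Yphi.
Qed.

End Models.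

(** * Young symmetrisers and isotypic components *)

Section YoungSymmetriser.
Variables (C : numClosedFieldType) (n : nat).
Local Notation G := [set: 'S_n]%G.
Local Notation aG := (regular_repr C G).

Definition row_sum la := \sum_(p in row_stab n la) aG p.
Definition col_sum la := \sum_(q in col_stab n la) (-1) ^+ (q : bool) *: aG q.

Lemma young_symE la : young_sym C n la = gring_row (row_sum la *m col_sum la).
Proof.
congr gring_row; rewrite mulmx_suml; apply: eq_bigr => p _.
rewrite mulmx_sumr; apply: eq_bigr => q _.
by rewrite -scalemxAr repr_mxM ?inE.
Qed.

Lemma row_sumM la p : p \in row_stab n la -> row_sum la *m aG p = row_sum la.
Proof.
move=> pR; rewrite mulmx_suml [RHS](reindex_inj (mulIg p)) /=.
apply: eq_big => [s|s _]; last by rewrite repr_mxM ?inE.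
move: pR; rewrite !inE => /forallP pR; apply: eq_forallb => i.
by rewrite permM (eqP (pR _)).
Qed.

Lemma col_sumM la q :
  q \in col_stab n la -> col_sum la *m aG q = (-1) ^+ (q : bool) *: col_sum la.
Proof.
move=> qK; rewrite mulmx_suml scaler_sumr.
rewrite [RHS](reindex_inj (mulIg q)) /=.
apply: eq_big => [s|s _].
  move: qK; rewrite !inE => /forallP qK; apply: eq_forallb => i.
  by rewrite permM (eqP (qK _)).
rewrite odd_permM signr_addb -scalemxAl repr_mxM ?inE // scalerA.
by rewrite mulrCA -expr2 sqrr_sign mulr1.
Qed.

(** A box is determined by its row and its column. *)
Lemma row_col_trivial la p q :
  p \in row_stab n la -> q \in col_stab n la -> (p * q)%g = 1%g -> p = 1%g.
Proof.
rewrite !inE => /forallP pR /forallP qK pq1; apply/permP => i; rewrite perm1.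
apply: val_inj; rewrite /= -(reshape_indexK la (p i)) -[RHS](reshape_indexK la i).
rewrite (eqP (pR i)); congr flatten_index.
have := eqP (qK (p i)); by rewrite -permM pq1 perm1.
Qed.

(** The coefficient at the identity is 1, since only the trivial pair [(p, q)]
    has product 1. *)
Lemma young_sym_neq0 la : young_sym C n la != 0.
Proof.
apply/eqP => /(congr1 (row (gring_index G 1) \o trmx)) /=; apply/eqP.
have -> : row (gring_index G 1) (young_sym C n la)^T =
   gring_proj 1 (\sum_(p in row_stab n la) \sum_(q in col_stab n la)
               (-1) ^+ q *: aG (p * q)%g) by [].
rewrite linear_sum (bigD1 1%g) /=; last first.
  by rewrite inE; apply/forallP => i; rewrite perm1.
rewrite linear_sum (bigD1 1%g) /=; last first.
  by rewrite inE; apply/forallP => i; rewrite perm1.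
rewrite linearZ /= gring_projE ?inE // mulg1 eqxx odd_perm1 expr0 scale1r.
rewrite !big1 ?addr0; first by rewrite trmx0 row0 oner_eq0.
  move=> p /andP[pR pN]; rewrite linear_sum big1 // => q qK.
  rewrite linearZ /= gring_projE ?inE //; case: eqP => [e|_]; last exact: scaler0.
  by rewrite (row_col_trivial pR qK (esym e)) eqxx in pN.
move=> q /andP[_ qN]; rewrite linearZ /= gring_projE ?inE // mul1g eq_sym.
by rewrite (negPf qN) scaler0.
Qed.

End YoungSymmetriser.

Section IsotypicCriterion.
Variables (k : nat) (d : 'I_k -> nat) (n : nat) (C : numClosedFieldType).
Local Notation G := [set: 'S_n]%G.
Variables (I : finType) (g : I -> 'S_n).
Hypothesis gen_g : <<[set g i | i in I]>>%g = G.
Variables (m : nat) (M : I -> 'M[C]_m).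
Hypothesis irrM : generator_irreducible M.

(** Main tool for membership in isotypic components: once the Young symmetriser
    generates a copy [Y0] of the model, every copy [Y] of the model in the
    tensor power lies in the isotypic component. *)
Lemma intertwiner_sub_isotypic (S : {set 'I_k}) la
    (Y0 : 'M[C]_(m, #|G|)) (Y : 'M[C]_(m, #|{: pow_idx d n}|)) :
  intertwines g M (regular_repr C G) Y0 ->
  (Y0 :=: cyclic_mx (regular_repr C G) (young_sym C n la))%MS ->
  intertwines g M (perm_repr d n C S) Y -> (Y <= isotypic d n C S la)%MS.
Proof.
move=> iY0 eY0 iY.
have nzY0 : Y0 != 0.
  by rewrite -(eqmx_eq0 (eqmx_sym eY0)) cyclic_mx_eq0 young_sym_neq0.
have [->|nzY] := eqVneq Y 0; first exact: sub0mx.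
have simY := intertwiner_simple gen_g irrM iY nzY.
have [W isoW] := Socle_iso (DecSocleType (perm_repr d n C S)) simY.
have YW : (Y <= W)%MS.
  by rewrite -(genmxE Y); apply: mx_iso_component => //; exact: socle_simple.
apply: submx_trans YW _; rewrite /isotypic (sumsmx_sup W) //; apply/asboolP.
have [modY _ _] := simY.
apply: (@mx_rsim_trans _ _ _ _ _ _ _ (submod_repr modY)).
  exact/mx_rsim_iso.
exact: (intertwiners_rsim gen_g irrM) iY iY0 nzY nzY0 (genmxE _) (eqmx_sym eY0).
Qed.

End IsotypicCriterion.

(** * The Specht modules of the partitions of 4 used below *)

(** The transpositions through 0 generate the symmetric group and give a family
    indexed by the points themselves (with the identity at 0). *)
Definition star_tperm n (i : 'I_n.+1) : 'S_n.+1 := tperm ord0 i.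

Lemma star_tperm_gen n : <<[set star_tperm i | i in 'I_n.+1]>>%g = [set: 'S_n.+1].
Proof. exact: gen_tperm. Qed.

Lemma odd_star_tperm n (i : 'I_n.+1) : star_tperm i = (ord0 != i) :> bool.
Proof. exact: odd_tperm. Qed.

Lemma scalar_irreducible (F : fieldType) (I : finType) (chi : I -> F) :
  generator_irreducible (fun i => (chi i)%:M : 'M_1).
Proof.
move=> U _ nzU; rewrite /row_full eqn_leq rank_leq_row /= lt0n mxrank_eq0.
exact: nzU.
Qed.

Section LinearSpecht.
Variables (k : nat) (d : 'I_k -> nat) (C : numClosedFieldType).
Local Notation aG := (regular_repr C [set: 'S_4]%G).

Lemma scalar_sub_isotypic (S : {set 'I_k}) la (chi : 'I_4 -> C)
    (Y : 'rV[C]_#|{: pow_idx d 4}|) :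
  (forall i, young_sym C 4 la *m aG (star_tperm i) = chi i *: young_sym C 4 la) ->
  (forall i, Y *m perm_repr d 4 C S (star_tperm i) = chi i *: Y) ->
  (Y <= isotypic d 4 C S la)%MS.
Proof.
move=> y_chi Y_chi.
have iy : intertwines (@star_tperm 3) (fun i => (chi i)%:M : 'M_1) aG
  (young_sym C 4 la) by move=> i; rewrite y_chi mul_scalar_mx.
apply: (intertwiner_sub_isotypic (star_tperm_gen 3)
  (@scalar_irreducible _ _ chi) iy); last first.
  by move=> i; rewrite Y_chi mul_scalar_mx.
apply/eqmxP; rewrite cyclic_mx_id cyclic_mx_sub ?submx_refl //.
exact: (intertwiner_module (star_tperm_gen 3) iy).
Qed.

Lemma fixed_sub_isotypic (S : {set 'I_k}) (Y : 'rV[C]_#|{: pow_idx d 4}|) :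
  (forall i, Y *m perm_repr d 4 C S (star_tperm i) = Y) ->
  (Y <= isotypic d 4 C S [:: 4])%MS.
Proof.
move=> fixY; apply: (@scalar_sub_isotypic _ _ (fun=> 1)) => i; last first.
  by rewrite fixY scale1r.
have K1 : col_stab 4 [:: 4] = [set 1%g].
  apply/setP => q; rewrite !inE; apply/forallP/eqP => [qK|-> i0]; last first.
    by rewrite perm1.
  apply/permP => j; apply: val_inj; rewrite perm1; have := eqP (qK j).
  by rewrite /reshape_offset /reshape_index /= !subn_eq0 !ltn_ord /= !subn0.
have cs1 : col_sum C 4 [:: 4] = 1%:M.
  by rewrite /col_sum K1 big_set1 odd_perm1 scale1r repr_mx1.
rewrite scale1r young_symE cs1 mulmx1 -gring_row_mul row_sumM // inE; apply/forallP => j.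
by rewrite /reshape_index /= !subn_eq0 !ltn_ord.
Qed.

Lemma alternating_sub_isotypic (S : {set 'I_k}) (Y : 'rV[C]_#|{: pow_idx d 4}|) :
  (forall i, Y *m perm_repr d 4 C S (star_tperm i)
             = (-1) ^+ (star_tperm i : bool) *: Y) ->
  (Y <= isotypic d 4 C S (nseq 4 1%N))%MS.
Proof.
move=> altY.
apply: (@scalar_sub_isotypic _ _ (fun i => (-1) ^+ (star_tperm i : bool))) => // i.
rewrite young_symE -gring_row_mul -mulmxA col_sumM; last first.
  rewrite inE; apply/forallP => j; move: (star_tperm i j) => j'.
  by case: j' => [[|[|[|[|j']]]] lt1] //; case: j => [[|[|[|[|j]]]] lt2].
by rewrite -scalemxAr linearZ.
Qed.
End LinearSpecht.

Section GarnirRelation.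
Variables (F : fieldType) (n N m : nat).
Variables (rG : mx_representation F [set: 'S_n]%G N) (R : 'M[F]_(m, N)).
Local Notation t i j := (rG (tperm i j)).

Lemma repr_tpermJ i j (s : 'S_n) : t i j *m rG s = rG s *m t (s i) (s j).
Proof. by rewrite -!repr_mxM ?inE // conjgC tpermJ. Qed.

Lemma repr_tperm2 i j : t i j *m t i j = 1%:M.
Proof. by rewrite -repr_mxM ?inE // tperm2 repr_mx1. Qed.

(** The matrix on the right is the antisymmetriser of [i, j, k]; it is killed
    from the left by anything symmetric under one of the transpositions of these
    points. *)
Lemma antisymmetriser_vanish i j k : i != j -> j != k -> i != k ->
  R *m t i j = R -> R *m ((1%:M - t j k) *m (1%:M - t i j - t i k)) = 0.
Proof.
move=> ij jk ik Rij.
have e1 : t j k *m t i j = t i j *m t i k.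
  by rewrite repr_tpermJ tpermR tpermD.
have e2 : t j k *m t i k = t i j *m t j k.
  rewrite repr_tpermJ tpermR tpermD ?(eq_sym k) // (tpermC j i) repr_tpermJ.
  by rewrite tpermL tpermD.
rewrite mulmxBl mul1mx !mulmxBr mulmx1 e1 e2 !mulmxA Rij mulmx1.
by rewrite subrr sub0r [_ - R *m t i k]addrC addrK opprK addNr.
Qed.
End GarnirRelation.

(** Garnir relation of the partition (2, 2), with rows [i j] and [l k] and
    columns [i l] and [j k].  Expanding the antisymmetriser of the column [i l]
    leaves the antisymmetriser of [i, j, k] and, after conjugation, that of
    [l, j, k]; both meet a row of the tableau in two points. *)
Lemma garnir_relation (F : fieldType) (n N m : nat)
    (rG : mx_representation F [set: 'S_n]%G N) (R : 'M[F]_(m, N)) i j k l :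
  uniq [:: i; j; k; l] ->
  R *m rG (tperm i j) = R -> R *m rG (tperm l k) = R ->
  R *m ((1%:M - rG (tperm i l)) *m (1%:M - rG (tperm j k)))
    *m (1%:M - rG (tperm i j) - rG (tperm i k)) = 0.
Proof.
rewrite /= !inE !negb_or !andbT => /andP[/and3P[ij ik il] /andP[/andP[jk jl] kl]].
move=> Rij Rlk; rewrite mulmxA -mulmxA mulmxBr mulmx1 mulmxBl.
rewrite antisymmetriser_vanish // sub0r.
have -> : R *m rG (tperm i l) *m
   ((1%:M - rG (tperm j k)) *m (1%:M - rG (tperm i j) - rG (tperm i k))) =
   R *m ((1%:M - rG (tperm k j)) *m (1%:M - rG (tperm l k) - rG (tperm l j)))
     *m rG (tperm i l).
  have f1 : (1%:M - rG (tperm k j)) *m rG (tperm i l) =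
            rG (tperm i l) *m (1%:M - rG (tperm j k)).
    by rewrite mulmxBl mulmxBr mul1mx mulmx1 repr_tpermJ (tpermC j) !tpermD // eq_sym.
  have f2 : (1%:M - rG (tperm l k) - rG (tperm l j)) *m rG (tperm i l) =
            rG (tperm i l) *m (1%:M - rG (tperm i j) - rG (tperm i k)).
    rewrite !mulmxBl !mulmxBr mul1mx mulmx1 (repr_tpermJ _ l k).
    by rewrite (repr_tpermJ _ l j) tpermR !tpermD ?(eq_sym l) // addrAC.
  by rewrite -!mulmxA f2 !mulmxA -(mulmxA R _ (rG (tperm i l))) f1 !mulmxA.
by rewrite antisymmetriser_vanish ?mul0mx ?oppr0 // eq_sym.
Qed.

Local Notation i0 := (@ord0 3).
Local Notation i1 := (@Ordinal 4 1 isT).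
Local Notation i2 := (@Ordinal 4 2 isT).
Local Notation i3 := (@Ordinal 4 3 isT).

Lemma ord4P (P : 'I_4 -> Prop) : P i0 -> P i1 -> P i2 -> P i3 -> forall i, P i.
Proof.
move=> P0 P1 P2 P3 [[|[|[|[|//]]]] lt4].
- by rewrite (_ : Ordinal lt4 = i0) //; apply: val_inj.
- by rewrite (_ : Ordinal lt4 = i1) //; apply: val_inj.
- by rewrite (_ : Ordinal lt4 = i2) //; apply: val_inj.
- by rewrite (_ : Ordinal lt4 = i3) //; apply: val_inj.
Qed.

Lemma col_stab22 : col_stab 4 [:: 2; 2]%N =
  [set 1%g; tperm i0 i2; tperm i1 i3; (tperm i0 i2 * tperm i1 i3)%g].
Proof.
apply/setP => q; apply/idP/idP; last first.
  rewrite !inE -!orbA => /or4P[] /eqP->; apply/forallP; apply: ord4P;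
   by rewrite !permE /= ?permE.
rewrite inE => /forallP qK.
have even_col (j : 'I_4) :
    reshape_offset [:: 2; 2]%N j == 0%N -> j = i0 \/ j = i2.
  by elim/ord4P: j => //; [left | right].
have odd_col (j : 'I_4) :
    reshape_offset [:: 2; 2]%N j == 1%N -> j = i1 \/ j = i3.
  by elim/ord4P: j => //; [left | right].
have q_inj (i j : 'I_4) : i != j -> q i != q j by rewrite (inj_eq perm_inj).
have := q_inj i0 i2 isT; have := q_inj i1 i3 isT.
rewrite !inE -!orbA.
case: (even_col _ (qK i0)) => q0; case: (even_col _ (qK i2)) => q2;
  rewrite q0 q2 //; case: (odd_col _ (qK i1)) => q1;
  case: (odd_col _ (qK i3)) => q3; rewrite q1 q3 // => _ _.
- apply/or4P; apply: Or41; apply/eqP/permP; apply: ord4P;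
   by rewrite ?(q0, q1, q2, q3) !permE /= ?permE.
- apply/or4P; apply: Or43; apply/eqP/permP; apply: ord4P;
   by rewrite ?(q0, q1, q2, q3) !permE /= ?permE.
- apply/or4P; apply: Or42; apply/eqP/permP; apply: ord4P;
   by rewrite ?(q0, q1, q2, q3) !permE /= ?permE.
- apply/or4P; apply: Or44; apply/eqP/permP; apply: ord4P;
   by rewrite ?(q0, q1, q2, q3) !permE /= ?permE.
Qed.

Definition mx22 (F : fieldType) (a b c e : F) : 'M[F]_2 :=
  \matrix_(i, j) if i == 0 then (if j == 0 then a else b)
                 else (if j == 0 then c else e).

Section SquareSpecht.
Variable F : numFieldType.

(** Matrices of the transpositions (0 i) on the Specht module of (2, 2), in the
    basis formed by a polytabloid [y] and [y * (0 1)]. *)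
Definition square_mx (i : 'I_4) : 'M[F]_2 :=
  match val i with
  | 0%N => 1%:M
  | 1%N => mx22 0 1 1 0
  | 2%N => mx22 (-1) 0 (-1) 1
  | _ => mx22 1 (-1) 0 (-1)
  end.

(** Every nonzero stable subspace contains the eigenvector [e] of (0 2) for -1:
    subtracting from a vector its image under (0 2) gives a multiple of [e],
    which is nonzero for the vector itself or for its image under (0 1). *)
Lemma square_irreducible : generator_irreducible square_mx.
Proof.
move=> U stU /rowV0Pn[w wU nzw].
have stW (v : 'rV_2) i : (v <= U)%MS -> (v *m square_mx i <= U)%MS.
  by move=> vU; apply: submx_trans (submxMr _ vU) (stU i).
pose e : 'rV[F]_2 := delta_mx 0 0; pose f : 'rV[F]_2 := delta_mx 0 1.
have row2E (v : 'rV[F]_2) : v = v 0 0 *: e + v 0 1 *: f.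
  apply/rowP => j; rewrite !mxE /=; case: j => [[|[|//]] lt2] /=;
  rewrite ?mulr0 ?mulr1 ?addr0 ?add0r; congr (v 0 _); exact: val_inj.
have ea : e *m square_mx i1 = f.
  by rewrite -rowE; apply/rowP => j; rewrite !mxE /=; case: j => [[|[|//]] lt2].
have fa : f *m square_mx i1 = e.
  by rewrite -rowE; apply/rowP => j; rewrite !mxE /=; case: j => [[|[|//]] lt2].
have eb : e *m square_mx i2 = - e.
  rewrite -rowE; apply/rowP => j; rewrite !mxE /=.
  by case: j => [[|[|//]] lt2] //=; rewrite oppr0.
have fb : f *m square_mx i2 = f - e.
  rewrite -rowE; apply/rowP => j; rewrite !mxE /=.
  by case: j => [[|[|//]] lt2] //=; rewrite ?sub0r ?subr0.
have eU : (e <= U)%MS.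
  have main (v : 'rV_2) : (v <= U)%MS -> 2 * v 0 0 + v 0 1 != 0 -> (e <= U)%MS.
    move=> vU nz.
    have : (v - v *m square_mx i2 <= U)%MS.
      by rewrite addmx_sub ?eqmx_opp ?stW.
    rewrite [v in X in (X <= _)%MS]row2E mulmxDl -!scalemxAl eb fb.
    have -> : v 0 0 *: e + v 0 1 *: f - (v 0 0 *: - e + v 0 1 *: (f - e)) =
       (2 * v 0 0 + v 0 1) *: e.
      by apply/rowP => j; rewrite !mxE; ring.
    by rewrite eqmx_scale.
  have [w2|] := eqVneq (2 * w 0 0 + w 0 1) 0; last exact: main.
  have w01 : w 0 1 = - (2 * w 0 0).
    by apply/eqP; rewrite -subr_eq0 opprK addrC w2.
  apply: (main _ (stW _ i1 wU)).
  rewrite [w]row2E mulmxDl -!scalemxAl ea fa !mxE /= w01.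
  have -> : 2 * (w 0 0 * 0 + - (2 * w 0 0) * 1) + (w 0 0 * 1 + - (2 * w 0 0) * 0)
     = - 3 * w 0 0 by ring.
  rewrite mulf_eq0 oppr_eq0 pnatr_eq0 /=; apply: contraNneq nzw => w00.
  by rewrite [w]row2E w01 w00 mulr0 oppr0 !scale0r addr0.
have fU : (f <= U)%MS by rewrite -ea stW.
rewrite -sub1mx; apply/row_subP => j; rewrite row1.
case: j => [[|[|//]] lt2].
  by rewrite (_ : Ordinal lt2 = 0) //; apply: val_inj.
by rewrite (_ : Ordinal lt2 = 1) //; apply: val_inj.
Qed.

Section Vector.
Variables (N : nat) (rG : mx_representation F [set: 'S_4]%G N).
Local Notation t i j := (rG (tperm i j)).

(** The column relations and the Garnir relations for the tableau with rows
    [0 1] and [2 3]: together they determine the action of the transpositions through 0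
    on [y] and [y * (0 1)]. *)
Definition garnir_vector (y : 'rV[F]_N) :=
  [/\ y *m t i0 i2 = - y, y *m t i1 i3 = - y,
      y *m t i0 i3 = y - y *m t i0 i1 & y *m t i1 i2 = y - y *m t i0 i1].

Definition square_pair (y : 'rV[F]_N) : 'M_(2, N) :=
  \matrix_i (if i == 0 then y else y *m t i0 i1).

Lemma square_pair_intertwines y :
  garnir_vector y -> intertwines (@star_tperm 3) square_mx rG (square_pair y).
Proof.
case=> y02 y13 y03 y12.
(* With [y] as in [garnir_vector], (0 1)(0 2) = (1 2)(0 1) and
   (0 1)(0 3) = (1 3)(0 1) reduce the action on [y * (0 1)] to known ones. *)
have za : y *m t i0 i1 *m t i0 i1 = y by rewrite -mulmxA repr_tperm2 mulmx1.
have zb : y *m t i0 i1 *m t i0 i2 = y *m t i0 i1 - y.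
  have -> : y *m t i0 i1 *m t i0 i2 = y *m t i1 i2 *m t i0 i1.
    by rewrite -!mulmxA [in RHS]repr_tpermJ tpermR tpermD.
  by rewrite y12 mulmxBl za.
have zc : y *m t i0 i1 *m t i0 i3 = - (y *m t i0 i1).
  have -> : y *m t i0 i1 *m t i0 i3 = y *m t i1 i3 *m t i0 i1.
    by rewrite -!mulmxA [in RHS]repr_tpermJ tpermR tpermD.
  by rewrite y13 mulNmx.
have rowM (A : 'M[F]_2) j :
    row j (A *m square_pair y) = A j 0 *: y + A j 1 *: (y *m t i0 i1).
  rewrite row_mul mulmx_sum_row !big_ord_recl big_ord0 addr0 !rowK !mxE.
  by congr (_ *: _ + A _ _ *: _); apply: val_inj.
elim/ord4P; apply/row_matrixP => j; rewrite rowM row_mul rowK /star_tperm.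
- rewrite tperm1 repr_mx1 mulmx1 !mxE.
  by case: j => [[|[|//]] lt2]; rewrite /= ?scale1r ?scale0r ?addr0 ?add0r.
- rewrite !mxE /=.
  by case: j => [[|[|//]] lt2]; rewrite /= ?za ?scale1r ?scale0r ?addr0 ?add0r.
- rewrite !mxE /=.
  case: j => [[|[|//]] lt2]; rewrite /= ?y02 ?zb ?scaleN1r ?scale1r ?scale0r.
    by rewrite addr0.
  by rewrite addrC.
rewrite !mxE /=.
case: j => [[|[|//]] lt2]; rewrite /= ?y03 ?zc ?scaleN1r ?scale1r ?scale0r //.
by rewrite add0r.
Qed.
End Vector.
End SquareSpecht.

(** The column group is generated by the commuting transpositions (0 2) and
    (1 3), so its signed sum factors as [garnir_relation] requires, in either
    order. *)
Lemma young_sym22_garnir (C : numClosedFieldType) :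
  garnir_vector (regular_repr C [set: 'S_4]%G) (young_sym C 4 [:: 2; 2]%N).
Proof.
pose la := [:: 2; 2]%N.
have K02 : tperm i0 i2 \in col_stab 4 la by rewrite col_stab22 !inE eqxx ?orbT.
have K13 : tperm i1 i3 \in col_stab 4 la by rewrite col_stab22 !inE eqxx ?orbT.
have R01 : tperm i0 i1 \in row_stab 4 la.
  by rewrite inE; apply/forallP; apply: ord4P; rewrite !permE.
have R23 : tperm i2 i3 \in row_stab 4 la.
  by rewrite inE; apply/forallP; apply: ord4P; rewrite !permE.
have colE : col_sum C 4 la =
    (1%:M - regular_repr C _ (tperm i0 i2)) *m (1%:M - regular_repr C _ (tperm i1 i3)).
  rewrite /col_sum col_stab22 -!finset.setUA !big_setU1 ?big_set1 /=; last 3 first.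
  - by rewrite !inE; apply/eqP => /permP /(_ i0); rewrite !permE /= ?permE.
  - rewrite !inE negb_or; apply/andP; split; apply/eqP => /permP.
      by move/(_ i0); rewrite !permE.
    by move/(_ i1); rewrite !permE /= ?permE.
  - rewrite !inE !negb_or; apply/and3P; split; apply/eqP => /permP.
    + by move/(_ i0); rewrite !permE.
    + by move/(_ i1); rewrite !permE.
    + by move/(_ i0); rewrite !permE /= ?permE.
  rewrite odd_perm1 !odd_permM !odd_tperm /= !scaleN1r !scale1r repr_mx1.
  rewrite !repr_mxM ?inE // !mulmxBl !mulmxBr !mul1mx !mulmx1 opprB.
  by rewrite -[RHS]addrA; congr (_ + _); rewrite addrC -addrA.
have yE s : young_sym C 4 la *m regular_repr C _ s =
   gring_row (row_sum C 4 la *m (col_sum C 4 la *m regular_repr C _ s)).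
  by rewrite young_symE -gring_row_mul mulmxA.
have garnir i j k l : uniq [:: i; j; k; l] ->
    tperm i j \in row_stab 4 la -> tperm l k \in row_stab 4 la ->
    col_sum C 4 la = (1%:M - regular_repr C _ (tperm i l)) *m
                     (1%:M - regular_repr C _ (tperm j k)) ->
    young_sym C 4 la *m regular_repr C _ (tperm i k) =
    young_sym C 4 la - young_sym C 4 la *m regular_repr C _ (tperm i j).
  move=> ijkl Rij Rlk cE.
  apply/eqP; rewrite eq_sym -subr_eq0 -{1}[young_sym C 4 la]mulmx1 -!mulmxBr.
  rewrite young_symE -gring_row_mul cE garnir_relation ?linear0 ?row_sumM //.
split; rewrite -/la.
- by rewrite yE col_sumM // odd_tperm scaleN1r mulmxN linearN /= -young_symE.
- by rewrite yE col_sumM // odd_tperm scaleN1r mulmxN linearN /= -young_symE.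
- by apply: (garnir i0 i1 i3 i2).
rewrite (tpermC i0 i1); apply: (garnir i1 i0 i2 i3) => //; try by rewrite tpermC.
have tt : regular_repr C [set: 'S_4]%G (tperm i1 i3) *m regular_repr C _ (tperm i0 i2)
   = regular_repr C _ (tperm i0 i2) *m regular_repr C _ (tperm i1 i3).
  by rewrite repr_tpermJ !tpermD.
rewrite colE !mulmxBl !mulmxBr !mul1mx !mulmx1 tt !opprB.
by rewrite addrACA [RHS]addrACA; congr (_ + _); exact: addrC.
Qed.

Section SquareIsotypic.
Variables (k : nat) (d : 'I_k -> nat) (C : numClosedFieldType) (S : {set 'I_k}).
Local Notation rS := (perm_repr d 4 C S).

(** The Young symmetriser itself satisfies the Garnir relations, so it and [y]
    carry the same model. *)
Lemma square_sub_isotypic (y : 'rV[C]_#|{: pow_idx d 4}|) :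
  garnir_vector rS y ->
  (y <= isotypic d 4 C S [:: 2; 2]%N)%MS /\
  (y *m rS (tperm i0 i1) <= isotypic d 4 C S [:: 2; 2]%N)%MS.
Proof.
move=> hy; pose w := young_sym C 4 [:: 2; 2]%N.
pose aG := regular_repr C [set: 'S_4]%G.
have iw : intertwines (@star_tperm 3) (square_mx C) aG (square_pair aG w).
  exact/square_pair_intertwines/young_sym22_garnir.
have rowP N (rG : mx_representation C [set: 'S_4]%G N) (v : 'rV_N) :
    (v <= square_pair rG v)%MS /\ (v *m rG (tperm i0 i1) <= square_pair rG v)%MS.
  split; first by apply: (eq_row_sub 0); rewrite rowK.
  by apply: (eq_row_sub 1); rewrite rowK.
have eqw : (square_pair aG w :=: cyclic_mx aG w)%MS.
  apply/eqmxP/andP; split; last first.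
    apply: cyclic_mx_sub; last by have [] := rowP _ aG w.
    exact: (intertwiner_module (star_tperm_gen 3) iw).
  apply/row_subP => j; rewrite rowK; case: ifP => _; first exact: cyclic_mx_id.
  by apply: mxmodule_trans (cyclic_mx_module _ _) _ (cyclic_mx_id _ _); rewrite inE.
have sub : (square_pair rS y <= isotypic d 4 C S [:: 2; 2]%N)%MS.
  apply: (intertwiner_sub_isotypic (star_tperm_gen 3) _ iw eqw).
    exact: square_irreducible.
  exact: square_pair_intertwines.
by have [y1 y2] := rowP _ rS y; split; apply: submx_trans sub.
Qed.
End SquareIsotypic.

(** * The invariant vector on four copies of four qubits *)

Section Brackets.
Variables (C : numClosedFieldType).
Implicit Types x y : 'I_4 -> C.

(** In terms of vectors [(1, x j)] of the plane, [bracketA] and [bracketB] are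
    the products of 2 x 2 determinants [01][23] and [02][13]; together with
    [03][12] = [02][13] - [01][23] they span the SL_2 invariants of four
    vectors. *)
Definition bracketA x := (x i1 - x i0) * (x i3 - x i2).
Definition bracketB x := (x i2 - x i0) * (x i3 - x i1).

(** On four points [(1, x j) (x) (1, y j)] of C^2 (x) C^2 this is, up to sign,
    their 4 x 4 determinant. *)
Definition bracketD x y := bracketA x * bracketB y - bracketB x * bracketA y.

Lemma bracket01 x : bracketA (x \o tperm i0 i1) = - bracketA x /\
  bracketB (x \o tperm i0 i1) = bracketB x - bracketA x.
Proof. by rewrite /bracketA /bracketB /= !permE /=; split; ring. Qed.
Lemma bracket02 x : bracketA (x \o tperm i0 i2) = bracketA x - bracketB x /\
  bracketB (x \o tperm i0 i2) = - bracketB x.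
Proof. by rewrite /bracketA /bracketB /= !permE /=; split; ring. Qed.
Lemma bracket03 x : bracketA (x \o tperm i0 i3) = bracketB x /\
  bracketB (x \o tperm i0 i3) = bracketA x.
Proof. by rewrite /bracketA /bracketB /= !permE /=; split; ring. Qed.
Lemma bracket12 x : bracketA (x \o tperm i1 i2) = bracketB x /\
  bracketB (x \o tperm i1 i2) = bracketA x.
Proof. by rewrite /bracketA /bracketB /= !permE /=; split; ring. Qed.
Lemma bracket13 x : bracketA (x \o tperm i1 i3) = bracketA x - bracketB x /\
  bracketB (x \o tperm i1 i3) = - bracketB x.
Proof. by rewrite /bracketA /bracketB /= !permE /=; split; ring. Qed.

Lemma bracketD_tperm x y i j : i != j ->
  bracketD (x \o tperm i j) (y \o tperm i j) = - bracketD x y.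
Proof.
by move: i j; apply: ord4P; apply: ord4P => // _;
  rewrite /bracketD /bracketA /bracketB /= !permE /=; ring.
Qed.
End Brackets.

Section InvariantVector.
Variables (k : nat) (d : 'I_k -> nat) (C : numClosedFieldType).
Implicit Types (S : {set 'I_k}) (X : pow_idx d 4) (p q : 'I_k).
Local Notation rS S := (perm_repr d 4 C S).

Definition pow_vec (f : pow_idx d 4 -> C) : 'rV[C]_#|{: pow_idx d 4}| :=
  \row_a f (enum_val a).

Lemma pow_vec_perm f S s :
  pow_vec f *m rS S s = pow_vec (fun X => f (perm_idx S s^-1 X)).
Proof.
apply/rowP => b; rewrite !mxE (bigD1 (enum_rank (perm_idx S s^-1 (enum_val b)))) //=.
rewrite !mxE enum_rankK -perm_idxM mulVg perm_idx1 eqxx mulr1 big1 ?addr0 // => a aN.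
rewrite !mxE; case: eqP => [e|_]; last by rewrite mulr0.
by move: aN; rewrite -e -perm_idxM mulgV perm_idx1 enum_valK eqxx.
Qed.

Lemma eq_pow_vec f g : f =1 g -> pow_vec f = pow_vec g.
Proof. by move=> fg; apply/rowP => a; rewrite !mxE fg. Qed.

Lemma pow_vec_tperm f S i j :
  pow_vec f *m rS S (tperm i j) = pow_vec (fun X => f (perm_idx S (tperm i j) X)).
Proof. by rewrite pow_vec_perm tpermV. Qed.

Lemma pow_vecN f : - pow_vec f = pow_vec (fun X => - f X).
Proof. by apply/rowP => a; rewrite !mxE. Qed.
Lemma pow_vecD f g : pow_vec f + pow_vec g = pow_vec (fun X => f X + g X).
Proof. by apply/rowP => a; rewrite !mxE. Qed.
Lemma pow_vecZ c f : c *: pow_vec f = pow_vec (fun X => c * f X).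
Proof. by apply/rowP => a; rewrite !mxE. Qed.

Definition coord p X : 'I_4 -> C := fun j => (nat_of_ord (X j p))%:R.

Lemma coord_perm_in p S i j X : p \in S ->
  coord p (perm_idx S (tperm i j) X) = coord p X \o tperm i j.
Proof. by move=> pS; apply/funext => l; rewrite /coord /= !ffunE pS tpermV. Qed.

Lemma coord_perm_out p S s X : p \notin S -> coord p (perm_idx S s X) = coord p X.
Proof.
by move=> pS; apply/funext => l; rewrite /coord /= !ffunE (negPf pS).
Qed.

Definition pairD p q X := bracketD (coord p X) (coord q X).

Lemma pairD_perm p q S i j X : (p \in S) = (q \in S) -> i != j ->
  pairD p q (perm_idx S (tperm i j) X) =
    (if p \in S then -1 else 1) * pairD p q X.
Proof.
move=> pq ij; rewrite /pairD; case: ifPn => pS.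
  by rewrite !coord_perm_in -?pq // bracketD_tperm // mulN1r.
by rewrite !coord_perm_out -?pq // mul1r.
Qed.

(** The span of the two brackets is the Specht module of (2, 2), and it stays so
    after the sign twist that occurs when [S] contains the other three parties:
    [bracketB] satisfies the Garnir relations untwisted, and
    [2 bracketA - bracketB] satisfies them when every transposition is given an
    additional sign. *)
Lemma bracket_sub_isotypic S p (eps : bool) (g : pow_idx d 4 -> C) :
  p \in S ->
  (forall i j X, i != j -> g (perm_idx S (tperm i j) X) = (-1) ^+ eps * g X) ->
  (pow_vec (fun X => bracketA (coord p X) * g X)%R <= isotypic d 4 C S [:: 2; 2]%N)%MS /\
  (pow_vec (fun X => bracketB (coord p X) * g X)%R <= isotypic d 4 C S [:: 2; 2]%N)%MS.
Proof.
move=> pS gE.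
case: eps gE => gE; last first.
  (* [02][13] is negated by the columns (0 2) and (1 3) of the tableau. *)
  set y := pow_vec (fun X => bracketB (coord p X) * g X).
  have y01 : y *m rS S (tperm i0 i1) =
      pow_vec (fun X => (bracketB (coord p X) - bracketA (coord p X)) * g X).
    rewrite pow_vec_tperm; apply: eq_pow_vec => X.
    by rewrite gE // coord_perm_in // (bracket01 _).2 mul1r.
  have hy : garnir_vector (rS S) y.
    split; rewrite ?y01 pow_vec_tperm ?pow_vecN ?pow_vecD; apply: eq_pow_vec => X;
      rewrite gE // coord_perm_in // ?(bracket02 _).2 ?(bracket13 _).2
         ?(bracket03 _).2 ?(bracket12 _).2; ring.
  have [yI zI] := square_sub_isotypic hy; split => //.
  have -> : pow_vec (fun X => bracketA (coord p X) * g X) =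
     y - y *m rS S (tperm i0 i1).
    by rewrite y01 pow_vecN pow_vecD; apply: eq_pow_vec => X; ring.
  by rewrite addmx_sub ?eqmx_opp.
(* The combination fixed by (0 2) and (1 3), negated by them after the twist. *)
set y := pow_vec (fun X => (2 * bracketA (coord p X) - bracketB (coord p X)) * g X).
have y01 : y *m rS S (tperm i0 i1) =
    pow_vec (fun X => (bracketA (coord p X) + bracketB (coord p X)) * g X).
  rewrite pow_vec_tperm; apply: eq_pow_vec => X.
  rewrite gE // coord_perm_in // (bracket01 _).1 (bracket01 _).2; ring.
have hy : garnir_vector (rS S) y.
  split; rewrite ?y01 pow_vec_tperm ?pow_vecN ?pow_vecD; apply: eq_pow_vec => X;
    rewrite gE // coord_perm_in // ?(bracket02 _).2 ?(bracket13 _).2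
      ?(bracket03 _).2 ?(bracket12 _).2 ?(bracket02 _).1 ?(bracket13 _).1
      ?(bracket03 _).1 ?(bracket12 _).1; ring.
have [yI zI] := square_sub_isotypic hy.
have nz3 : (3 : C) != 0 by rewrite pnatr_eq0.
split.
  have -> : pow_vec (fun X => bracketA (coord p X) * g X) =
     3^-1 *: (y + y *m rS S (tperm i0 i1)).
    by rewrite y01 pow_vecD pow_vecZ; apply: eq_pow_vec => X; field.
  by rewrite scalemx_sub ?addmx_sub.
have -> : pow_vec (fun X => bracketB (coord p X) * g X) =
   3^-1 *: (2 *: (y *m rS S (tperm i0 i1)) - y).
  by rewrite y01 pow_vecN pow_vecZ pow_vecD pow_vecZ; apply: eq_pow_vec => X; field.
by rewrite scalemx_sub ?addmx_sub ?eqmx_opp ?scalemx_sub.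
Qed.

End InvariantVector.

Section FourParties.
Variables (k : nat) (d : 'I_k -> nat) (C : numClosedFieldType).
Implicit Types (S : {set 'I_k}) (X : pow_idx d 4) (p q : 'I_k).

(** If [S] separates [p] from [q], only the brackets of one of the two move. *)
Lemma split_pair_sub_isotypic S p q (eps : bool) (g : pow_idx d 4 -> C) :
  (p \in S) != (q \in S) ->
  (forall i j X, i != j -> g (perm_idx S (tperm i j) X) = (-1) ^+ eps * g X) ->
  (pow_vec (fun X => pairD C p q X * g X)%R <= isotypic d 4 C S [:: 2; 2]%N)%MS.
Proof.
(* [pairD] is antisymmetric in the two parties. *)
wlog pS : p q / p \in S.
  move=> IH ne gE; have [pS|pS] := boolP (p \in S); first exact: IH.
  have qS : q \in S by move: ne; rewrite (negPf pS); case: (q \in S).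
  have -> : pow_vec (fun X => pairD C p q X * g X) =
      - pow_vec (fun X => pairD C q p X * g X).
    rewrite pow_vecN; apply: eq_pow_vec => X; rewrite /pairD /bracketD; ring.
  by rewrite eqmx_opp; apply: IH => //; rewrite eq_sym.
rewrite pS eq_sym eqb_id => qS gE.
have gE' (h : ('I_4 -> C) -> C) i j X : i != j ->
   h (coord C q (perm_idx S (tperm i j) X)) * g (perm_idx S (tperm i j) X) =
   (-1) ^+ eps * (h (coord C q X) * g X).
  by move=> ij; rewrite coord_perm_out // gE // mulrCA.
have [aI _] := bracket_sub_isotypic pS (gE' (@bracketB C)).
have [_ bI] := bracket_sub_isotypic pS (gE' (@bracketA C)).
have -> : pow_vec (fun X => pairD C p q X * g X) =
   pow_vec (fun X => bracketA (coord C p X) * (bracketB (coord C q X) * g X)) -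
   pow_vec (fun X => bracketB (coord C p X) * (bracketA (coord C q X) * g X)).
  by rewrite pow_vecN pow_vecD; apply: eq_pow_vec => X; rewrite /pairD /bracketD; ring.
by rewrite addmx_sub ?eqmx_opp.
Qed.

Variables p1 p2 p3 p4 : 'I_k.

(** The partition of 4 of largest entropy compatible with the trace of [S] on
    the four parties; meant for sides that do not separate both pairs. *)
Definition four_diagram S : seq nat :=
  if ((p1 \in S) == (p2 \in S)) && ((p3 \in S) == (p4 \in S)) then
    if (p1 \in S) == (p3 \in S) then [:: 4]%N else nseq 4 1%N
  else [:: 2; 2]%N.

Definition vol_fun X : C := pairD C p1 p2 X * pairD C p3 p4 X.
Definition vol_vec := pow_vec vol_fun.

Lemma vol_vec_tperm S i j : i != j ->
  (p1 \in S) = (p2 \in S) -> (p3 \in S) = (p4 \in S) ->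
  vol_vec *m perm_repr d 4 C S (tperm i j) =
   (-1) ^+ ((p1 \in S) != (p3 \in S)) *: vol_vec.
Proof.
move=> ij e12 e34; rewrite pow_vec_tperm pow_vecZ; apply: eq_pow_vec => X.
by rewrite /vol_fun !pairD_perm //; case: ifP; case: ifP => _ _ /=; ring.
Qed.

(** If [S] separates neither pair, a transposition multiplies each of the two
    factors of [vol_fun] by a sign; otherwise exactly one pair is separated and
    the factor of the other pair only contributes a sign. *)
Lemma vol_vec_isotypic S :
  ((p1 \in S) == (p2 \in S)) || ((p3 \in S) == (p4 \in S)) ->
  (vol_vec <= isotypic d 4 C S (four_diagram S))%MS.
Proof.
rewrite /four_diagram.
have [e12|n12] := eqVneq (p1 \in S) (p2 \in S);
  have [e34|n34] := eqVneq (p3 \in S) (p4 \in S) => //= _.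
- have vE i : vol_vec *m perm_repr d 4 C S (star_tperm i) =
      (if ord0 != i then (-1) ^+ ((p1 \in S) != (p3 \in S)) else 1) *: vol_vec.
    rewrite /star_tperm; have [<-|ni] := eqVneq ord0 i; last exact: vol_vec_tperm.
    by rewrite tperm1 repr_mx1 mulmx1 scale1r.
  have [e13|n13] := eqVneq (p1 \in S) (p3 \in S).
    apply: fixed_sub_isotypic => i; rewrite vE e13 eqxx expr0.
    by rewrite if_same scale1r.
  apply: alternating_sub_isotypic => i; rewrite vE odd_star_tperm n13.
  by case: ifP.
- have -> : vol_vec = pow_vec (fun X => pairD C p3 p4 X * pairD C p1 p2 X).
    by apply: eq_pow_vec => X; rewrite /vol_fun mulrC.
  apply: (@split_pair_sub_isotypic _ _ _ (p1 \in S)) => // i j X ij.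
  by rewrite pairD_perm //; case: ifP.
apply: (@split_pair_sub_isotypic _ _ _ (p3 \in S)) => // i j X ij.
by rewrite pairD_perm //; case: ifP.
Qed.

Lemma vol_vec_sym :
  (vol_vec <= rfix_mx (perm_repr d 4 C finset.setT) [set: 'S_4])%MS.
Proof.
suff fixG : [set: 'S_4] \subset rstab (perm_repr d 4 C finset.setT) vol_vec.
  by apply/rfix_mxP => s /(fintype.subsetP fixG); rewrite inE => /andP[_ /eqP].
rewrite -(star_tperm_gen 3) gen_subG; apply/fintype.subsetP => _ /imsetP[i _ ->].
rewrite inE finset.in_setT andTb; apply/eqP; rewrite /star_tperm.
have [<-|ni] := eqVneq ord0 i; first by rewrite tperm1 repr_mx1 mulmx1.
by rewrite vol_vec_tperm ?inE // scale1r.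
Qed.

End FourParties.

(** * The witness tensor and its upper functional *)

Section Witness.
Variables (R : realType) (k : nat) (p1 p2 p3 p4 : 'I_k) (w : nat).
Local Notation C := R[i]%C.
Local Open Scope sesquilinear_scope.

(** A qubit for each of the four parties, dimension 1 for the others; the
    successor form makes both kinds of index available without casts. *)
Definition four_dim (i : 'I_k) : nat := (i \in [:: p1; p2; p3; p4]).+1.
Local Notation d := four_dim.

(** Across [p1 p2 | p3 p4] this is the diagonal matrix diag(w, 1, 1, 1). *)
Definition witness : tensor R d :=
  [ffun x : idx d =>
     if (x p1 == x p3 :> nat) && (x p2 == x p4 :> nat)
     then (if (x p1 == 0 :> nat) && (x p2 == 0 :> nat) then w%:R else 1) else 0].

Lemma witness_ge0 x : 0 <= witness x.
Proof. by rewrite ffunE; case: ifP => // _; case: ifP => _; rewrite ?ler0n ?ler01. Qed.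

Lemma witness_diag x : witness x != 0 ->
  x p1 = x p3 :> nat /\ x p2 = x p4 :> nat.
Proof.
by rewrite ffunE; case: ifP => [/andP[/eqP -> /eqP ->] //|]; rewrite eqxx.
Qed.

Definition bits (u v : nat) : idx d :=
  [ffun i => inord (if i \in [:: p1; p3] then u else v) : 'I_(d i)].

(** An orthogonal projector does not change the pairing with a vector of its
    range. *)
Lemma ortho_projC n m (U : 'M[C]_(m, n)) (y : 'rV[C]_n) :
  (y <= U)%MS -> proj_ortho U *m y^t* = y^t*.
Proof.
case/submxP => D ->; rewrite trmx_mul map_mxM mulmxA; congr (_ *m _).
have := proj_ortho_compl_sub U (1%:M : 'M[C]_n).
move/orthomx1P; rewrite mulmxBl !mul1mx => /eqP; rewrite subr_eq0 => /eqP e.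
by rewrite [RHS]e.
Qed.

Hypotheses (w_gt0 : (0 < w)%N) (u12 : p1 != p2) (u14 : p1 != p4) (u23 : p2 != p3) (u34 : p3 != p4).

Lemma bitsE u v : (u < 2)%N -> (v < 2)%N ->
  [/\ bits u v p1 = u :> nat, bits u v p3 = u :> nat,
      bits u v p2 = v :> nat & bits u v p4 = v :> nat].
Proof.
move=> u2 v2; rewrite /bits; split; rewrite ffunE inordK ?inE ?eqxx ?orbT //=.
- by rewrite eq_sym (negPf u12) (negPf u23).
- by case: ifP.
- by rewrite eq_sym (negPf u14) eq_sym (negPf u34).
by case: ifP.
Qed.

(** On the support of the witness the coordinates of [p3, p4] copy those of
    [p1, p2], so that [vol_fun] is a square there and the pairing is a sum of
    nonnegative terms; the term at the four distinct pairs of bits is positive. *)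
Lemma witness_pair_neq0 :
  tensor_pow 4 witness *m (vol_vec d C p1 p2 p3 p4)^t* != 0.
Proof.
apply/eqP => /matrixP /(_ 0 0); rewrite !mxE => /eqP.
(* The four copies run through the four pairs of bits. *)
pose X0 : pow_idx d 4 := [ffun j : 'I_4 => bits (j %/ 2) (j %% 2)].
have pair_real (X : pow_idx d 4) : pairD C p1 p2 X \is Num.real.
  by rewrite /pairD /bracketD /bracketA /bracketB !(rpredB, rpredM, rpred_nat).
have vol_diag (X : pow_idx d 4) : (forall j, witness (X j) != 0) ->
    Num.conj_op (vol_fun (d := d) C p1 p2 p3 p4 X) = (pairD C p1 p2 X) ^+ 2.
  move=> Xd; rewrite /vol_fun.
  have c13 : coord C p3 X = coord C p1 X.
    by apply/funext => j; rewrite /coord; have [-> _] := witness_diag (Xd j).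
  have c24 : coord C p4 X = coord C p2 X.
    by apply/funext => j; rewrite /coord; have [_ ->] := witness_diag (Xd j).
  by rewrite {2}/pairD c13 c24 -expr2 rmorphXn /= (CrealP (pair_real X)).
have term_ge0 (X : pow_idx d 4) :
    0 <= (\prod_(j < 4) witness (X j)) * Num.conj_op (vol_fun (d := d) C p1 p2 p3 p4 X).
  have [/forallP Xd|] := boolP [forall j, witness (X j) != 0]; last first.
    rewrite negb_forall => /existsP[j]; rewrite negbK => /eqP wj.
    by rewrite (bigD1 j) //= wj !mul0r.
  rewrite mulr_ge0 ?prodr_ge0 // => [i _|]; first exact: witness_ge0.
  by rewrite vol_diag // real_exprn_even_ge0 // pair_real.
rewrite psumr_eq0 => [|a _]; last by rewrite !mxE; exact: term_ge0.
move/allP => /(_ (enum_rank X0)); rewrite mem_index_enum => /(_ isT).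
have bX0 (j : 'I_4) : [/\ X0 j p1 = (j %/ 2)%N :> nat,
    X0 j p3 = (j %/ 2)%N :> nat, X0 j p2 = (j %% 2)%N :> nat
    & X0 j p4 = (j %% 2)%N :> nat].
  by rewrite ffunE; apply: bitsE; rewrite ?ltn_divLR ?ltn_pmod.
rewrite !mxE enum_rankK mulf_eq0 => /orP[|].
  rewrite prodf_seq_eq0 => /hasP[j _]; rewrite andTb; apply/negP.
  have [b1 b3 b2 b4] := bX0 j.
  rewrite ffunE b1 b2 b3 b4 !eqxx /=; case: ifP => _; last exact: oner_neq0.
  by rewrite pnatr_eq0 -lt0n.
rewrite vol_diag => [|j].
  rewrite expf_eq0 /= /pairD /bracketD /bracketA /bracketB /coord.
  have [-> _ -> _] := bX0 i0; have [-> _ -> _] := bX0 i1.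
  have [-> _ -> _] := bX0 i2; have [-> _ -> _] := bX0 i3.
  have halves : [/\ i0 %/ 2 = 0, i1 %/ 2 = 0, i2 %/ 2 = 1 & i3 %/ 2 = 1]%N by [].
  have parities : [/\ i0 %% 2 = 0, i1 %% 2 = 1, i2 %% 2 = 0 & i3 %% 2 = 1]%N by [].
  have [-> -> -> ->] := halves; have [-> -> -> ->] := parities.
  by rewrite !subrr !subr0 !mulr1 !mul0r sub0r oppr_eq0 oner_eq0.
have [b1 b3 b2 b4] := bX0 j.
rewrite ffunE b1 b2 b3 b4 !eqxx /=; case: ifP => _; last exact: oner_neq0.
by rewrite pnatr_eq0 -lt0n.
Qed.
End Witness.

Section UpperBound.
Variables (R : realType) (k : nat) (p1 p2 p3 p4 : 'I_k) (w : nat).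
Local Notation C := R[i]%C.
Local Notation d := (four_dim p1 p2 p3 p4).
Local Notation psi := (witness R p1 p2 p3 p4 w).
Local Open Scope sesquilinear_scope.
Hypotheses (w_gt0 : (0 < w)%N) (u12 : p1 != p2) (u14 : p1 != p4)
  (u23 : p2 != p3) (u34 : p3 != p4).

Definition four_height (S : {set 'I_k}) : nat :=
  if ((p1 \in S) == (p2 \in S)) && ((p3 \in S) == (p4 \in S)) then
    if (p1 \in S) == (p3 \in S) then 0%N else 2%N
  else 1%N.

Lemma ln2_neq0 : ln 2 != 0 :> R.
Proof. by rewrite gt_eqF // ln_gt0 // ltr1n. Qed.

Lemma part_entropy_diagram S :
  part_entropy R 4 (four_diagram p1 p2 p3 p4 S) = (four_height S)%:R.
Proof.
have ln2 := ln2_neq0.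
have ln4V : ln (1 / 4 : R) = - (2 * ln 2).
  rewrite div1r lnV ?posrE // (_ : 4 = 2 ^+ 2 :> R); last by rewrite -natrX.
  by rewrite lnXn // mulr_natl.
have ln2V : ln (2 / 4 : R) = - ln 2.
  rewrite (_ : 2 / 4 = 2^-1 :> R); last by field.
  by rewrite lnV ?posrE.
rewrite /part_entropy /four_diagram /four_height /shannon.
case: ifP => _; first case: ifP => _.
- by rewrite big_seq1 divff // ln1 mul0r mulr0 oppr0.
- by rewrite /= !big_cons big_nil ln4V; field.
by rewrite /= !big_cons big_nil ln2V; field.
Qed.

Lemma witness_neq0 : psi != 0.
Proof.
apply: contraNneq (witness_pair_neq0 R w_gt0 u12 u14 u23 u34) => ->.
apply/eqP; apply: etrans (mul0mx _ _); congr (_ *m _); apply/rowP => a.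
by rewrite !mxE big_ord_recl /= ffunE mul0r.
Qed.

(** [vol_vec] lies in the range of all the projectors and pairs nontrivially with
    the fourth power of the witness. *)
Lemma E_upper_witness (theta : bipart k -> R) :
  (forall b, theta b != 0 -> ((p1 \in side b) == (p2 \in side b)) ||
                             ((p3 \in side b) == (p4 \in side b))) ->
  ((\sum_b theta b * (four_height (side b))%:R)%:E <= E_upper theta psi)%E.
Proof.
move=> noncrossing; rewrite /E_upper (negPf witness_neq0).
apply: (@le_trans _ _ (ereal_sup
      [set (\sum_(b | theta b != 0) theta b * part_entropy R 4 (la b))%:E
        | la in [set la | admissible theta psi 4 la]]%classic)); last first.
  by apply: ereal_sup_ubound => /=; exists 4%N.
apply: ereal_sup_ubound => /=.
exists (fun b => four_diagram p1 p2 p3 p4 (side b)); last first.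
  congr (_%:E); rewrite [RHS](bigID (fun b => theta b != 0)) /=.
  rewrite [X in _ + X]big1 ?addr0 => [|b]; last first.
    by rewrite negbK => /eqP ->; rewrite mul0r.
  by apply: eq_bigr => b _; rewrite part_entropy_diagram.
split=> [b _|]; first by rewrite /four_diagram; case: ifP => // _; case: ifP.
pose v := vol_vec d C p1 p2 p3 p4.
apply: contraNneq (witness_pair_neq0 R w_gt0 u12 u14 u23 u34) => prod0.
(* Every factor fixes [v] from the left, hence so does the product. *)
suff <- : (\big[mulmx/1%:M]_(b | theta b != 0)
    bip_proj d 4 C b (four_diagram p1 p2 p3 p4 (side b))) *m v^t* = v^t*.
  by rewrite mulmxA prod0 mul0mx.
apply: (big_ind (fun A : 'M[C]_#|{: pow_idx d 4}| => A *m v^t* = v^t*)).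
- by rewrite mul1mx.
- by move=> A B Av Bv; rewrite -mulmxA Bv.
move=> b /noncrossing nc; rewrite /bip_proj -mulmxA.
by rewrite !ortho_projC //; [exact: vol_vec_sym | exact: vol_vec_isotypic].
Qed.

End UpperBound.

(** * Entropy inequalities *)

Section EntropyBounds.
Variables (R : realType) (I : finType) (p : I -> R).
Hypothesis p_ge0 : forall i, 0 <= p i.
Hypothesis p_sum : \sum_i p i = 1.

(** Tangent inequality of the concave function [- x ln x]. *)
Lemma xlnx_tangent (x y : R) : 0 <= x -> 0 < y ->
  - (x * ln x) <= - (x * ln y) + (y - x).
Proof.
move=> x0 y0; have [->|xn] := eqVneq x 0.
  by rewrite !mul0r !oppr0 add0r addr0 ltW.
have xp : 0 < x by rewrite lt_neqAle eq_sym xn.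
have : ln (y / x) <= y / x - 1.
  rewrite -{1}[y / x](addrNK 1) addrC le_ln1Dx // ltrBrDl subrr.
  exact: divr_gt0.
rewrite ln_div ?posrE // => le1.
have : x * (ln y - ln x) <= x * (y / x - 1) by rewrite ler_pM2l.
have -> : x * (y / x - 1) = y - x by field.
lra.
Qed.

Lemma ln2_gt0 : 0 < ln 2 :> R.
Proof. by rewrite ln_gt0 // ltr1n. Qed.

Lemma entropy_sumE : - \sum_i p i * (ln (p i) / ln 2) =
  (\sum_i - (p i * ln (p i))) / ln 2.
Proof.
by rewrite mulr_suml -sumrN; apply: eq_bigr => i _; rewrite mulrA mulNr.
Qed.

(** Comparison with the uniform distribution on [r] points. *)
Lemma entropy_le_support (r : nat) : (0 < r)%N -> (#|[pred i | p i != 0%R]| <= r)%N ->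
  - \sum_i p i * (ln (p i) / ln 2) <= ln r%:R / ln 2.
Proof.
move=> r0 supp; rewrite entropy_sumE ler_pM2r ?invr_gt0 ?ln2_gt0 //.
have rR : 0 < r%:R :> R by rewrite ltr0n.
have -> : ln r%:R = \sum_i p i * ln r%:R :> R by rewrite -mulr_suml p_sum mul1r.
rewrite -subr_le0 -sumrB.
apply: (@le_trans _ _ (\sum_i ((p i != 0)%:R / r%:R - p i))).
  apply: ler_sum => i _; have [pi0|pin] := eqVneq (p i) (0 : R).
    by rewrite pi0 !mul0r !oppr0 addr0.
  have := @xlnx_tangent (p i) (r%:R)^-1 (p_ge0 i).
  rewrite invr_gt0 => /(_ rR); rewrite lnV ?posrE // mulrN opprK div1r; lra.
rewrite sumrB p_sum -mulr_suml subr_le0 ler_pdivrMr // mul1r.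
rewrite -natr_sum ler_nat; apply: leq_trans supp.
rewrite -sum1_card [X in (_ <= X)%N]big_mkcond; apply: leq_sum => i _.
by rewrite inE; case: ifP.
Qed.

(** Cross entropy against the distribution (1/16, 5/16, 5/16, 5/16), for a
    distribution whose first weight is 1/16. *)
Definition gap_bound : R := (ln (16 / 5) + ln 5 / 16) / ln 2.

Lemma gap_bound_ge0 : 0 <= gap_bound.
Proof.
rewrite /gap_bound divr_ge0 ?(ltW ln2_gt0) // addr_ge0 ?divr_ge0 ?ln_ge0 //; lra.
Qed.

(** Amounts to [2 ^ 32 < 5 ^ 15]; in two steps through [2 ^ 16 < 5 ^ 7]. *)
Lemma gap_bound_lt2 : gap_bound < 2.
Proof.
rewrite /gap_bound ltr_pdivrMr ?ln2_gt0 //.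
have e16 : ln 16 = 4 * ln 2 :> R.
  by rewrite (_ : 16 = 2 ^+ 4) ?lnXn // -?natrX // mulr_natl.
rewrite ln_div ?posrE // e16.
have ln5 : 16 * ln 2 < 7 * ln 5 :> R.
  by rewrite !mulr_natl -!lnXn // ltr_ln ?posrE ?exprn_gt0 // !exprS !expr0; lra.
have : 0 < ln 5 :> R by rewrite ln_gt0 // ltr1n.
lra.
Qed.

(** A small product forces some weight to be at most 1/16, and comparison with
    (1/16, 5/16, 5/16, 5/16), the small weight being put there, bounds the
    entropy. *)
Lemma entropy_gap : #|I| = 4%N -> \prod_i p i <= 16^-1 ^+ 4 ->
  - \sum_i p i * (ln (p i) / ln 2) <= gap_bound.
Proof.
move=> card4 prod_le.
have [j pj] : exists j, p j <= 16^-1.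
  apply/existsP; apply: contraLR prod_le; rewrite negb_exists -ltNge => /forallP big.
  have [j0 _] : exists j0 : I, true.
    by case: (pickP I) => [j0|I0]; [exists j0 | rewrite (eq_card0 I0) in card4].
  rewrite -[X in _ ^+ X]card4 -prodr_const; apply: ltr_prod => [|i _].
    by apply/hasP; exists j0; rewrite ?mem_index_enum.
  by have := big i; rewrite -ltNge => ->; rewrite invr_ge0 ler0n.
rewrite entropy_sumE ler_pM2r ?invr_gt0 ?ln2_gt0 //.
pose q i : R := if i == j then 16^-1 else 5 / 16.
have q_gt0 i : 0 < q i by rewrite /q; case: ifP => _; rewrite ?divr_gt0 ?invr_gt0 ?ltr0n.
have cardj : #|[pred i | i != j]| = 3%N.
  by have := cardC1 j; rewrite card4.
have q_sum : \sum_i q i = 1.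
  rewrite (bigD1 j) //= {1}/q eqxx (eq_bigr (fun=> 5 / 16)); last first.
    by move=> i /negPf ij; rewrite /q ij.
  by rewrite sumr_const cardj; field.
apply: (@le_trans _ _ (\sum_i (- (p i * ln (q i)) + (q i - p i)))).
  by apply: ler_sum => i _; exact: xlnx_tangent.
rewrite big_split /= sumrB q_sum p_sum subrr addr0.
have ln16 : ln 16 = ln (16 / 5) + ln 5 :> R by rewrite ln_div ?posrE ?ltr0n // subrK.
have -> : \sum_i - (p i * ln (q i)) = ln (16 / 5) + p j * ln 5.
  rewrite (bigD1 j) //= {1}/q eqxx lnV ?posrE ?ltr0n // ln16 mulrN opprK.
  rewrite (eq_bigr (fun i => p i * ln (16 / 5))); last first.
    move=> i /negPf ij; rewrite /q ij -mulrN -lnV ?posrE ?divr_gt0 ?ltr0n //.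
    by rewrite invf_div.
  rewrite -mulr_suml.
  have -> : \sum_(i | i != j) p i = 1 - p j.
    by rewrite -p_sum [in RHS](bigD1 j) //= [RHS]addrC addKr.
  ring.
have : 0 < ln 5 :> R by rewrite ln_gt0 // ltr1n.
move=> ln5; rewrite lerD2l [leRHS]mulrC ler_pM2r //.
Qed.

End EntropyBounds.

(** * Spectra of density operators *)

(** The nonzero diagonal entries form an invertible minor. *)
Lemma card_support_le_rank (F : fieldType) n (v : 'rV[F]_n) :
  (#|[pred i | v 0%R i != 0%R]| <= \rank (diag_mx v))%N.
Proof.
set S := [pred i | _]; pose f := @enum_val _ S.
pose D : 'M[F]_(#|S|, n) := \matrix_(i, j) (f i == j)%:R.
pose E : 'M[F]_(n, #|S|) := \matrix_(j, i) ((f i == j)%:R / v 0 j).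
have DE : D *m diag_mx v *m E = 1%:M.
  apply/matrixP => i i'; rewrite mul_mx_diag !mxE (bigD1 (f i)) //= !mxE eqxx mul1r.
  rewrite big1 ?addr0 => [|j /negPf ji]; last by rewrite !mxE eq_sym ji !mul0r.
  rewrite (inj_eq enum_val_inj) eq_sym mulrCA mulfV ?mulr1 //.
  by have := enum_valP i; rewrite inE.
rewrite -[X in (X <= _)%N](mxrank1 F) -DE.
by apply: leq_trans (mxrankM_maxl _ _) (mxrankM_maxr _ _).
Qed.

Section GramSpectrum.
Variables (R : realType) (m n : nat).
Local Notation C := R[i]%C.
Local Open Scope sesquilinear_scope.
Variables (F : 'M[C]_(m, n)) (c : C).
Hypothesis c_ge0 : 0 <= c.
Let rho := c *: (F *m F^t*).
Let P := spectralmx rho.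
Definition gram_eigenvalue (i : 'I_m) : R := complex.Re (spectral_diag rho 0 i).

Lemma gram_hermitian : rho \is hermsymmx.
Proof.
apply/is_hermitianmxP; rewrite expr0 scale1r /rho linearZ /= map_mxZ.
rewrite trmx_mul map_mxM trmxCK; congr (_ *: _).
by rewrite /= (CrealP _) // ger0_real.
Qed.

Lemma gram_spectral : rho = invmx P *m diag_mx (spectral_diag rho) *m P.
Proof. exact/orthomx_spectralP/hermitian_normalmx/gram_hermitian. Qed.

Lemma gram_diag : P *m rho *m P^t* = diag_mx (spectral_diag rho).
Proof.
rewrite [in X in _ *m X *m _]gram_spectral !mulmxA mulmxV ?spectral_unit // mul1mx.
by rewrite -mulmxA (unitarymxP (spectral_unitarymx rho)) mulmx1.
Qed.

Lemma gram_diag_ge0 i : 0 <= spectral_diag rho 0 i.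
Proof.
have -> : spectral_diag rho 0 i = (P *m rho *m P^t*) i i.
  by rewrite gram_diag !mxE eqxx mulr1n.
rewrite /rho -scalemxAr -scalemxAl mxE mulr_ge0 //.
have -> : P *m (F *m F^t*) *m P^t* = (P *m F) *m (P *m F)^t*.
  by rewrite trmx_mul map_mxM !mulmxA.
by rewrite mxE sumr_ge0 // => j _; rewrite [X in _ * X]mxE [X in _ * X^*]mxE mul_conjC_ge0.
Qed.

Lemma gram_eigenvalueE i : (gram_eigenvalue i)%:C%C = spectral_diag rho 0 i.
Proof. by rewrite /gram_eigenvalue RRe_real // ger0_real // gram_diag_ge0. Qed.

Lemma gram_eigenvalue_ge0 i : 0 <= gram_eigenvalue i.
Proof. by have := gram_diag_ge0 i; rewrite -gram_eigenvalueE lecR. Qed.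

Lemma gram_eigenvalue_sum : (\sum_i gram_eigenvalue i)%:C%C = \tr rho.
Proof.
rewrite gram_spectral mxtrace_mulC mulmxA mulmxV ?spectral_unit // mul1mx.
by rewrite mxtrace_diag rmorph_sum; apply: eq_bigr => i _; rewrite -gram_eigenvalueE.
Qed.

Lemma gram_eigenvalue_prod : (\prod_i gram_eigenvalue i)%:C%C = \det rho.
Proof.
rewrite gram_spectral !det_mulmx mulrAC -det_mulmx mulVmx ?spectral_unit //.
rewrite det1 mul1r det_diag rmorph_prod.
by apply: eq_bigr => i _; rewrite -gram_eigenvalueE.
Qed.

Lemma gram_eigenvalue_support :
  (#|[pred i | gram_eigenvalue i != 0%R]| <= minn m n)%N.
Proof.
have : (\rank (diag_mx (spectral_diag rho)) <= minn m n)%N.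
  rewrite -gram_diag /rho -scalemxAr -scalemxAl.
  have [->|c0] := eqVneq c 0; first by rewrite scale0r mxrank0.
  rewrite mxrank_scale_nz // leq_min rank_leq_row /=.
  have -> : P *m (F *m F^t*) *m P^t* = (P *m F) *m (F^t* *m P^t*).
    by rewrite !mulmxA.
  by apply: leq_trans (mxrankM_maxl _ _) _; exact: rank_leq_col.
apply: leq_trans.
rewrite (@eq_card _ _ [pred i | spectral_diag rho 0%R i != 0%R]).
  exact: card_support_le_rank.
by move=> i; rewrite !inE -gram_eigenvalueE fmorph_eq0.
Qed.

Lemma gram_entropy : vn_entropy rho =
  - \sum_i gram_eigenvalue i * (ln (gram_eigenvalue i) / ln 2).
Proof. by rewrite /vn_entropy /shannon big_image /=. Qed.
End GramSpectrum.

Section Densities.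
Variables (R : realType) (k : nat) (d : 'I_k -> nat).
Local Notation C := R[i]%C.
Local Open Scope sesquilinear_scope.
Implicit Types (S : {set 'I_k}) (psi : tensor R d).

Definition restrict_idx S (x : idx d) : sub_idx d S := [ffun i => x (val i)].
Arguments restrict_idx : clear implicits.

Lemma merge_in S (a : sub_idx d S) (b : sub_idx d (~: S)%SET) i (iS : i \in S) :
  Defs.merge a b i = a (exist _ i iS).
Proof.
rewrite ffunE; case: {-}_ / boolP => [iS'|nS]; last by have := nS; rewrite iS.
by congr (a (exist _ i _)); apply: bool_irrelevance.
Qed.

Lemma merge_out S (a : sub_idx d S) (b : sub_idx d (~: S)%SET) i
  (iS : i \in (~: S)%SET) : Defs.merge a b i = b (exist _ i iS).
Proof.
rewrite ffunE; case: {-}_ / boolP => [iS'|nS]; first by have := iS; rewrite inE iS'.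
by congr (b (exist _ i _)); apply: bool_irrelevance.
Qed.

Lemma merge_bij S : bijective
  (fun ab : sub_idx d S * sub_idx d (~: S)%SET => Defs.merge ab.1 ab.2).
Proof.
exists (fun x => (restrict_idx S x, restrict_idx (~: S)%SET x)) => [[a b]|x] /=.
  congr pair; apply/ffunP => -[i iS]; rewrite ffunE /=.
    exact: merge_in.
  exact: merge_out.
apply/ffunP => i; have [iS|iS] := boolP (i \in S).
  by rewrite (merge_in _ _ iS) ffunE.
by rewrite (merge_out _ _ (notin_setC iS)) ffunE.
Qed.

Lemma sum_merge (V : nmodType) S (f : idx d -> V) :
  \sum_(a : 'I_#|{: sub_idx d S}|) \sum_(b : 'I_#|{: sub_idx d (~: S)%SET}|)
     f (Defs.merge (enum_val a) (enum_val b)) = \sum_x f x.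
Proof.
rewrite [RHS](reindex _ (onW_bij _ (merge_bij S))) /=.
rewrite -(pair_bigA _ (fun a b => f (Defs.merge a b))) /=.
rewrite [RHS](reindex _ (onW_bij _ (@enum_val_bij _))) /=.
apply: eq_bigr => a _.
by rewrite [RHS](reindex _ (onW_bij _ (@enum_val_bij _))).
Qed.

Definition sqnorm psi : C := \sum_x `|psi x| ^+ 2.

Lemma sqnorm_ge0 psi : 0 <= sqnorm psi.
Proof. by rewrite sumr_ge0 // => x _; rewrite exprn_ge0. Qed.

Lemma sqnorm_gt0 psi : psi != 0 -> 0 < sqnorm psi.
Proof.
move=> nz; rewrite lt_neqAle sqnorm_ge0 andbT eq_sym.
apply: contraNneq nz => /eqP; rewrite psumr_eq0 => [/allP z|x _]; last first.
  by rewrite exprn_ge0.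
apply/eqP/ffunP => x; rewrite ffunE; have := z x; rewrite mem_index_enum.
by move=> /(_ isT); rewrite expf_eq0 normr_eq0 => /eqP.
Qed.

Lemma trace_gram S psi :
  \tr (flattening S psi *m (flattening S psi)^t*) = sqnorm psi.
Proof.
rewrite /sqnorm -(sum_merge S); apply: eq_bigr => a _.
by rewrite mxE; apply: eq_bigr => b _; rewrite !mxE -normCK.
Qed.

Lemma inv_sqnorm_ge0 psi : 0 <= (sqnorm psi)^-1.
Proof. by rewrite invr_ge0 sqnorm_ge0. Qed.

Local Notation eigs S psi :=
  (gram_eigenvalue (flattening S psi) (sqnorm psi)^-1).

Lemma density_eigs_sum S psi : psi != 0 -> \sum_i eigs S psi i = 1.
Proof.
move=> nz; apply: (@complexI R); rewrite /= gram_eigenvalue_sum ?inv_sqnorm_ge0 //.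
by rewrite mxtraceZ trace_gram mulVf // gt_eqF // sqnorm_gt0.
Qed.

(** Covers the degenerate value of the density of the zero tensor, whose
    normalising factor is the inverse of 0. *)
Lemma density0_entropy S : vn_entropy (density S (0 : tensor R d)) = 0.
Proof.
rewrite [vn_entropy _](gram_entropy (flattening S 0) (sqnorm 0)^-1).
have F0 : flattening S (0 : tensor R d) = 0 by apply/matrixP => a b; rewrite !mxE ffunE.
have c0 : 0 <= (sqnorm (0 : tensor R d))^-1 by exact: inv_sqnorm_ge0.
have := gram_eigenvalue_sum (flattening S (0 : tensor R d)) c0.
rewrite {2}F0 mul0mx scaler0 mxtrace0 => /complexI/eqP.
rewrite psumr_eq0 => [/allP z|i _]; last exact: gram_eigenvalue_ge0.
rewrite big1 ?oppr0 // => i _; have := z i; rewrite mem_index_enum.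
by move=> /(_ isT) /eqP ->; rewrite mul0r.
Qed.

Lemma density_entropy_le S psi r : (0 < r)%N ->
  (minn #|{: sub_idx d S}| #|{: sub_idx d (~: S)%SET}| <= r)%N ->
  vn_entropy (density S psi) <= ln r%:R / ln 2.
Proof.
move=> r0 le_r; have [->|nz] := eqVneq psi 0.
  by rewrite density0_entropy divr_ge0 ?ln_ge0 ?ler1n.
rewrite [vn_entropy _](gram_entropy (flattening S psi) (sqnorm psi)^-1).
apply: entropy_le_support => //.
- by move=> i; apply: gram_eigenvalue_ge0; exact: inv_sqnorm_ge0.
- exact: density_eigs_sum.
by apply: leq_trans le_r; apply: gram_eigenvalue_support; exact: inv_sqnorm_ge0.
Qed.

Lemma density_entropy_gap S psi : #|{: sub_idx d S}| = 4%N ->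
  \det (flattening S psi *m (flattening S psi)^t*) <= (sqnorm psi / 16) ^+ 4 ->
  vn_entropy (density S psi) <= gap_bound R.
Proof.
move=> card4 det_le; have [->|nz] := eqVneq psi 0.
  by rewrite density0_entropy gap_bound_ge0.
have s_gt0 := sqnorm_gt0 nz.
rewrite [vn_entropy _](gram_entropy (flattening S psi) (sqnorm psi)^-1).
apply: entropy_gap => //.
- by move=> i; apply: gram_eigenvalue_ge0; exact: inv_sqnorm_ge0.
- exact: density_eigs_sum.
- by rewrite card_ord.
rewrite -lecR gram_eigenvalue_prod ?inv_sqnorm_ge0 // detZ [X in _ ^+ X * _]card4.
apply: le_trans (ler_wpM2l _ det_le) _; first by rewrite exprn_ge0 ?inv_sqnorm_ge0.
rewrite -exprMn mulrA mulVf ?gt_eqF // mul1r rmorphXn /= fmorphV rmorph_nat.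
exact: lexx.
Qed.

Lemma card_sub_idx S : #|{: sub_idx d S}| = (\prod_(i in S) d i)%N.
Proof.
rewrite -(bij_eq_card (dffun_of_fprod_bij
  (fun i : {i : 'I_k | i \in S} => fintype_ordinal__canonical__fintype_Finite (d (val i))))).
rewrite card_fprod [RHS]big_sub; apply: eq_bigr => i _; exact: card_ord.
Qed.

End Densities.

(** * Invariants of local transformations *)

(** Distributivity for index ranges that depend on the factor. *)
Lemma prod_sum_dffun (R : comNzRingType) (I : finType) (d : I -> nat)
    (F : forall i, 'I_(d i) -> R) :
  \prod_i \sum_j F i j = \sum_(x : {dffun forall i, 'I_(d i)}) \prod_i F i (x i).
Proof.
pose T_ (i : I) := fintype_ordinal__canonical__fintype_Finite (d i).
rewrite [RHS](reindex _ (onW_bij _ (dffun_of_fprod_bij T_))) /=.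
transitivity (\sum_(t : fprod T_) \prod_(i in I) [ffun j => F i j] (t i)).
  rewrite big_fprod.
  transitivity (\prod_i \sum_(u in tagged_with T_ i)
                  untag 0 [ffun j : T_ i => F i j] u).
    apply: eq_bigr => i _; rewrite -(big_tag (fun i => [ffun j : T_ i => F i j])).
    by apply: eq_bigr => j _; rewrite ffunE.
  by rewrite bigA_distr_big_dep.
by apply: eq_bigr => t _; apply: eq_bigr => i _; rewrite !ffunE.
Qed.

Section FinMatrix.
Variable C : comNzRingType.

(** Matrices indexed by finite types, so that products are sums over the types
    themselves instead of their enumerations. *)
Definition fmx (T U : finType) (f : T -> U -> C) : 'M[C]_(#|T|, #|U|) :=
  \matrix_(a, b) f (enum_val a) (enum_val b).

Lemma eq_fmx (T U : finType) (f g : T -> U -> C) : f =2 g -> fmx f = fmx g.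
Proof. by move=> fg; apply/matrixP => a b; rewrite !mxE fg. Qed.

Lemma sum_enum_val (T : finType) (f : T -> C) :
  \sum_(a < #|T|) f (enum_val a) = \sum_x f x.
Proof. by rewrite [RHS](reindex _ (onW_bij _ (@enum_val_bij _))). Qed.

Lemma fmx_mul (T U V : finType) (f : T -> U -> C) (g : U -> V -> C) :
  fmx f *m fmx g = fmx (fun x z => \sum_y f x y * g y z).
Proof.
apply/matrixP => a b; rewrite !mxE -(sum_enum_val (fun y => f _ y * g y _)).
by apply: eq_bigr => c _; rewrite !mxE.
Qed.

Lemma fmx_tr (T U : finType) (f : T -> U -> C) : (fmx f)^T = fmx (fun x y => f y x).
Proof. by apply/matrixP => a b; rewrite !mxE. Qed.

Lemma fmx_scale (T U : finType) (f : T -> U -> C) c :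
  c *: fmx f = fmx (fun x y => c * f x y).
Proof. by apply/matrixP => a b; rewrite !mxE. Qed.
End FinMatrix.

Section AlternatingForm.
Variable C : numClosedFieldType.

(** For [b = true] the determinant form of C^2 (index 0 against 1 gives 1), for
    [b = false] the unit form of a line: in both cases every matrix scales it. *)
Definition alt_form (b : bool) (x y : 'I_b.+1) : C :=
  if b then (y : nat)%:R - (x : nat)%:R else 1.

Lemma alt_form_scale (b : bool) (A : 'M[C]_(b.+1)) :
  exists delta, forall x y,
    \sum_u \sum_v A u x * alt_form u v * A v y = delta * alt_form x y.
Proof.
case: b A => A; last first.
  exists (A 0 0 ^+ 2) => x y; rewrite /alt_form !big_ord1 (ord1 x) (ord1 y).
  by rewrite !mulr1 expr2.
exists (A 0 0 * A 1 1 - A 1 0 * A 0 1) => x y.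
rewrite !big_ord_recl !big_ord0 /alt_form /=.
have -> : lift ord0 ord0 = 1 :> 'I_2 by exact: val_inj.
have ord2P (z : 'I_2) : z = 0 \/ z = 1.
  by case: z => [[|[|//]] lt2]; [left | right]; apply: val_inj.
by case: (ord2P x) => ->; case: (ord2P y) => -> /=; ring.
Qed.

Lemma alt_form_orth (b : bool) (x x' : 'I_b.+1) :
  \sum_y alt_form x y * alt_form x' y = (x == x')%:R.
Proof.
case: b x x' => x x'; last by rewrite big_ord1 /alt_form mulr1 (ord1 x) (ord1 x').
rewrite !big_ord_recl !big_ord0 /alt_form /=.
case: x => [[|[|//]] lt2]; case: x' => [[|[|//]] lt2'];
  by rewrite -val_eqE /bump /=; ring.
Qed.

Lemma alt_form_norm (b : bool) (x : 'I_b.+1) : \sum_y `|alt_form x y| = 1.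
Proof.
case: b x => x; last by rewrite big_ord1 /alt_form normr1.
rewrite !big_ord_recl !big_ord0 /alt_form /=.
case: x => [[|[|//]] lt2] /=.
  by rewrite subrr normr0 subr0 normr1 add0r addr0.
by rewrite subrr normr0 sub0r normrN normr1 !addr0.
Qed.

Lemma alt_form_normC (b : bool) (x y : 'I_b.+1) :
  `|alt_form x y| = `|alt_form y x|.
Proof. by rewrite /alt_form; case: b x y => // x y; rewrite distrC. Qed.

Variables (I : finType) (b : I -> bool).
Notation T := {dffun forall i, 'I_(b i).+1}.

Definition prod_form (x y : T) : C := \prod_i alt_form (x i) (y i).
Definition prod_mx (A : forall i, 'M[C]_((b i).+1)) (x y : T) : C :=
  \prod_i A i (x i) (y i).

Lemma prod_form_scale (A : forall i, 'M[C]_((b i).+1)) (delta : I -> C) :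
  (forall i x y, \sum_u \sum_v A i u x * alt_form u v * A i v y
                 = delta i * alt_form x y) ->
  (fmx (prod_mx A))^T *m fmx prod_form *m fmx (prod_mx A) =
  (\prod_i delta i) *: fmx prod_form.
Proof.
move=> Adelta; rewrite fmx_tr !fmx_mul fmx_scale; apply: eq_fmx => x y.
transitivity (\prod_i \sum_v \sum_u A i u (x i) * alt_form u v * A i v (y i)).
  rewrite (prod_sum_dffun (fun i v => \sum_u A i u (x i) * alt_form u v * A i v (y i))).
  apply: eq_bigr => v _.
  rewrite (prod_sum_dffun (fun i u => A i u (x i) * alt_form u (v i) * A i (v i) (y i))).
  by rewrite mulr_suml; apply: eq_bigr => u _; rewrite !big_split.
rewrite /prod_form -big_split; apply: eq_bigr => i _.
by rewrite exchange_big Adelta.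
Qed.

Lemma prod_form_orth : fmx prod_form *m (fmx prod_form)^T = 1%:M.
Proof.
rewrite fmx_tr fmx_mul; apply/matrixP => a c; rewrite !mxE.
set x := enum_val a; set y := enum_val c.
transitivity (\sum_(z : T) \prod_i (alt_form (x i) (z i) * alt_form (y i) (z i))).
  by apply: eq_bigr => z _; rewrite big_split.
rewrite -(prod_sum_dffun (fun i z => alt_form (x i) z * alt_form (y i) z)).
rewrite -(inj_eq enum_val_inj) -/x -/y.
have [->|xy] := eqVneq x y.
  by rewrite big1 // => i _; rewrite alt_form_orth eqxx.
have [i xyi] : exists i, x i != y i.
  apply/existsP; apply: contraNT xy; rewrite negb_exists => /forallP e.
  by apply/eqP/ffunP => i; apply/eqP; rewrite -[_ == _]negbK e.
by rewrite (bigD1 i) //= alt_form_orth (negPf xyi) mul0r.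
Qed.

Lemma prod_form_norm x : \sum_y `|prod_form x y| = 1.
Proof.
transitivity (\sum_(y : T) \prod_i `|alt_form (x i) (y i)|).
  by apply: eq_bigr => y _; rewrite normr_prod.
rewrite -(prod_sum_dffun (fun i z => `|alt_form (x i) z|)) big1 // => i _.
exact: alt_form_norm.
Qed.

Lemma prod_form_normC x y : `|prod_form x y| = `|prod_form y x|.
Proof. by rewrite !normr_prod; apply: eq_bigr => i _; exact: alt_form_normC. Qed.

Definition quad_inv (f : T -> C) : C := \sum_x \sum_y prod_form x y * (f x * f y).

(** Each row and each column of the form has one nonzero entry, of modulus 1,
    so this is the inequality [2 |x y| <= |x| ^ 2 + |y| ^ 2]. *)
Lemma quad_inv_le f : `|quad_inv f| <= \sum_x `|f x| ^+ 2.
Proof.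
have amgm x y : `|prod_form x y * (f x * f y)| <=
    (`|prod_form x y| * `|f x| ^+ 2 + `|prod_form y x| * `|f y| ^+ 2) / 2.
  rewrite !normrM (prod_form_normC y x) -mulrDr -mulrA ler_wpM2l //.
  rewrite ler_pdivlMr // -subr_ge0.
  rewrite (_ : _ - _ = (`|f x| - `|f y|) ^+ 2); last by ring.
  by rewrite real_exprn_even_ge0 // rpredB // normr_real.
have nsum : \sum_x \sum_y `|prod_form x y| * `|f x| ^+ 2 = \sum_x `|f x| ^+ 2.
  by apply: eq_bigr => x _; rewrite -mulr_suml prod_form_norm mul1r.
apply: le_trans (ler_norm_sum _ _ _) _.
apply: (@le_trans _ _ (\sum_x \sum_y
    (`|prod_form x y| * `|f x| ^+ 2 + `|prod_form y x| * `|f y| ^+ 2) / 2)).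
  apply: ler_sum => x _; apply: le_trans (ler_norm_sum _ _ _) _.
  by apply: ler_sum => y _; exact: amgm.
rewrite (eq_bigr (fun x => (\sum_y `|prod_form x y| * `|f x| ^+ 2 +
   \sum_y `|prod_form y x| * `|f y| ^+ 2) / 2)); last first.
  by move=> x _; rewrite -mulr_suml -big_split.
rewrite -mulr_suml big_split /= nsum exchange_big /= nsum.
by rewrite -mulr2n -[_ *+ 2]mulr_natr mulfK ?pnatr_eq0.
Qed.

Lemma quad_inv_scale (A : forall i, 'M[C]_((b i).+1)) (delta : I -> C) (f : T -> C) :
  (forall i x y, \sum_u \sum_v A i u x * alt_form u v * A i v y
                 = delta i * alt_form x y) ->
  quad_inv (fun x => \sum_y prod_mx A x y * f y) = (\prod_i delta i) * quad_inv f.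
Proof.
move=> /prod_form_scale scale; pose V := fmx (fun (x : T) (_ : unit) => f x).
have qE (g : T -> C) (W := fmx (fun (x : T) (_ : unit) => g x)) :
    W^T *m fmx prod_form *m W = fmx (fun _ _ => quad_inv g).
  rewrite /W fmx_tr !fmx_mul; apply: eq_fmx => _ _; rewrite /quad_inv exchange_big.
  by apply: eq_bigr => y _; rewrite mulr_suml; apply: eq_bigr => x _; ring.
have := qE (fun x => \sum_y prod_mx A x y * f y).
rewrite /= (_ : fmx _ = fmx (prod_mx A) *m V); last by rewrite fmx_mul.
rewrite trmx_mul !mulmxA -(mulmxA V^T) -(mulmxA V^T) scale -scalemxAr -scalemxAl qE.
move/matrixP => /(_ (enum_rank tt) (enum_rank tt)); by rewrite !mxE.
Qed.

End AlternatingForm.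

Section LocalAction.
Variables (R : realType) (k : nat) (act : 'I_k -> bool).
Local Notation C := R[i]%C.
Local Notation d := (fun i => (act i).+1).
Local Open Scope sesquilinear_scope.
Variables (A : forall i : 'I_k, 'M[C]_((act i).+1)) (S : {set 'I_k}).
Implicit Type psi : tensor R d.

(** A named restriction of [act], which lets the dimensions of [sub_idx] unify
    with those of [prod_form]. *)
Definition side_act (B : {set 'I_k}) (i : {i : 'I_k | i \in B}) : bool := act (val i).

Definition side_mx (B : {set 'I_k}) : 'M[C]_#|{: sub_idx d B}| :=
  fmx (prod_mx (b := @side_act B) (fun i => A (val i))).

Definition side_form (B : {set 'I_k}) : 'M[C]_#|{: sub_idx d B}| :=
  fmx (@prod_form C _ (@side_act B)).

Lemma prod_side (f : 'I_k -> C) :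
  \prod_i f i = (\prod_(i : {i | i \in S}) f (val i)) *
                (\prod_(i : {i | i \in (~: S)%SET}) f (val i)).
Proof.
rewrite -(big_sub S f) -(big_sub (~: S)%SET f) [LHS](bigID (mem S)) /=.
by congr (_ * _); apply: eq_bigl => i; rewrite inE.
Qed.

Lemma flattening_tensor_app psi :
  flattening S (tensor_app A psi) =
  side_mx S *m flattening S psi *m (side_mx (~: S)%SET)^T.
Proof.
have -> : flattening S psi = fmx (fun a b => psi (Defs.merge a b)) by [].
rewrite /side_mx fmx_tr !fmx_mul; apply/matrixP => u v; rewrite !mxE.
set a := enum_val u; set b := enum_val v.
rewrite ffunE -(sum_merge S) exchange_big /=.
rewrite -(sum_enum_val (fun b' => (\sum_a' _ * psi (Defs.merge a' b')) * _)).
apply: eq_bigr => v' _.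
rewrite -(sum_enum_val (fun a' => _ * psi (Defs.merge a' _))) mulr_suml.
apply: eq_bigr => u' _; rewrite prod_side mulrAC; congr (_ * _ * _).
  by apply: eq_bigr => -[i iS] _ /=; rewrite !(merge_in _ _ iS).
by apply: eq_bigr => -[i iS] _ /=; rewrite !(merge_out _ _ iS).
Qed.

Variable delta : 'I_k -> C.
Hypothesis deltaP : forall i x y,
  \sum_u \sum_v A i u x * alt_form C u v * A i v y = delta i * alt_form C x y.

(** Taking determinants in [K^T E K = delta E] gives [det K] up to sign without
    expanding a Kronecker product. *)
Lemma det_side_mx B :
  \det (side_mx B) ^+ 2 = (\prod_(i : {i | i \in B}) delta (val i)) ^+ #|{: sub_idx d B}|.
Proof.
have := prod_form_scale (b := @side_act B) (fun i => @deltaP (val i)).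
rewrite -/(side_mx B) -/(side_form B) => /(congr1 determinant).
rewrite !det_mulmx det_tr detZ mulrAC -expr2.
apply: mulIf; have := congr1 determinant (@prod_form_orth C _ (@side_act B)).
rewrite -/(side_form B) det_mulmx det_tr det1; apply: contra_eq_neq => ->.
by rewrite mul0r eq_sym oner_neq0.
Qed.

Lemma det_gram_mul m n (K : 'M[C]_m) (F : 'M_(m, n)) (L : 'M_n) : m = n ->
  \det (K *m F *m L^T *m (K *m F *m L^T)^t*) =
  `|\det K| ^+ 2 * `|\det L| ^+ 2 * \det (F *m F^t*).
Proof.
move=> mn; case: _ / mn F L => F L.
by rewrite !det_mulmx !det_map_mx !det_tr !det_mulmx !det_tr !rmorphM !normCK; ring.
Qed.

(** The squared modulus of the flattening determinant scales by [|delta| ^ 4],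
    that is like [|quad_inv| ^ 4]. *)
Lemma det_gram_tensor_app psi :
  #|{: sub_idx d S}| = 4%N -> #|{: sub_idx d (~: S)%SET}| = 4%N ->
  \det (flattening S (tensor_app A psi) *m (flattening S (tensor_app A psi))^t*) =
  `|\prod_i delta i| ^+ 4 * \det (flattening S psi *m (flattening S psi)^t*).
Proof.
move=> cS cSc; rewrite flattening_tensor_app det_gram_mul; last by rewrite cS cSc.
rewrite -!normrX !det_side_mx [X in _ ^+ X]cS [X in _ * `|_ ^+ X|]cSc.
by rewrite -normrM -exprMn -prod_side.
Qed.
End LocalAction.

(** * The lower functional of the witness *)

Section WitnessBounds.
Variables (R : realType) (k : nat) (p1 p2 p3 p4 : 'I_k) (w : nat).
Local Notation C := R[i]%C.
Local Open Scope sesquilinear_scope.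
Local Notation parties := [:: p1; p2; p3; p4].
Local Notation d := (four_dim p1 p2 p3 p4).
Local Notation act := (fun i => i \in parties).
Local Notation psi := (witness R p1 p2 p3 p4 w).
Hypothesis parties_uniq : uniq parties.

Lemma prod_parties (f : 'I_k -> C) :
  \prod_i (if i \in parties then f i else 1) = f p1 * f p2 * f p3 * f p4.
Proof.
by rewrite -big_mkcond -big_uniq //= !big_cons big_nil mulr1 !mulrA.
Qed.

Lemma uniq_parties_neq :
  [/\ p1 != p2, p1 != p3, p1 != p4, p2 != p3 & p2 != p4] /\ p3 != p4.
Proof.
by move: parties_uniq; rewrite /= !inE !negb_or !andbT -!andbA => /and5P[-> -> -> -> /andP[-> ->]].
Qed.

(** On the support of the witness the form is a square, so the sum has no
    cancellation; the pair of indices 0000 and 1111 contributes [w]. *)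
Lemma quad_inv_witness : w%:R <= quad_inv (b := act) (C := C) psi.
Proof.
have term x y : prod_form C (b := act) x y * (psi x * psi y) =
   (((y p1 : nat)%:R - (x p1 : nat)%:R) * ((y p2 : nat)%:R - (x p2 : nat)%:R)) ^+ 2
     * (psi x * psi y).
  have [->|px] := eqVneq (psi x) 0; first by rewrite mul0r !mulr0.
  have [->|py] := eqVneq (psi y) 0; first by rewrite !mulr0.
  have [x13 x24] := witness_diag px; have [y13 y24] := witness_diag py.
  congr (_ * _); rewrite /prod_form /alt_form.
  rewrite (prod_parties (fun i => (y i : nat)%:R - (x i : nat)%:R)).
  by rewrite x13 x24 y13 y24; ring.
have term_ge0 x y : 0 <= prod_form C (b := act) x y * (psi x * psi y).
  rewrite term; apply: mulr_ge0; last by apply: mulr_ge0; exact: witness_ge0.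
  exact: real_exprn_even_ge0.
have [[n12 n13 n14 n23 n24] n34] := uniq_parties_neq.
pose x0 : idx d := bits p1 p2 p3 p4 0 0; pose y0 : idx d := bits p1 p2 p3 p4 1 1.
have [x1 x3 x2 x4] := bitsE n12 n14 n23 n34 (isT : 0 < 2)%N (isT : 0 < 2)%N.
have [y1 y3 y2 y4] := bitsE n12 n14 n23 n34 (isT : 1 < 2)%N (isT : 1 < 2)%N.
rewrite /quad_inv (bigD1 x0) //= (bigD1 y0) //= -addrA.
have -> : prod_form C (b := act) x0 y0 * (psi x0 * psi y0) = w%:R.
  have px : psi x0 = w%:R by rewrite ffunE x1 x2 x3 x4.
  have py : psi y0 = 1 by rewrite ffunE y1 y2 y3 y4.
  by rewrite term px py x1 x2 y1 y2; ring.
rewrite lerDl addr_ge0 //; first by rewrite sumr_ge0.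
by rewrite sumr_ge0 // => x _; rewrite sumr_ge0.
Qed.

Lemma card_side (S : {set 'I_k}) : #|{: sub_idx d S}| =
  (2 ^ ((p1 \in S) + (p2 \in S) + (p3 \in S) + (p4 \in S)))%N.
Proof.
rewrite card_sub_idx /four_dim.
transitivity (\prod_(i in S) 2 ^ (i \in parties))%N.
  by apply: eq_bigr => i _; case: (i \in parties).
rewrite -expn_sum; congr (2 ^ _)%N.
rewrite big_mkcond /= (eq_bigr (fun i => if i \in parties then (i \in S : nat) else 0%N)).
  by rewrite -big_mkcond -big_uniq //= !big_cons big_nil addn0 !addnA.
by move=> i _; case: (i \in S); case: (i \in parties).
Qed.

Variable S : {set 'I_k}.
Hypotheses (p1S : p1 \in S) (p2S : p2 \in S) (p3S : p3 \notin S) (p4S : p4 \notin S).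

(** The Gram matrix is diagonal, with entries [w ^ 2], 1, 1, 1. *)
Lemma det_gram_witness : (0 < w)%N ->
  \det (flattening S psi *m (flattening S psi)^t*) <= w%:R ^+ 2.
Proof.
move=> w_gt0.
pose u1 (a : sub_idx d S) : nat := a (exist _ p1 p1S).
pose u2 (a : sub_idx d S) : nat := a (exist _ p2 p2S).
have psiE a (b : sub_idx d (~: S)%SET) : psi (Defs.merge a b) =
   if (u1 a == b (exist _ p3 (notin_setC p3S)) :> nat) &&
      (u2 a == b (exist _ p4 (notin_setC p4S)) :> nat)
   then (if (u1 a == 0%N) && (u2 a == 0%N) then w%:R else 1) else 0.
  rewrite ffunE !(merge_in _ _ p1S) !(merge_in _ _ p2S).
  by rewrite (merge_out _ _ (notin_setC p3S)) (merge_out _ _ (notin_setC p4S)).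
have psi_supp a (b : sub_idx d (~: S)%SET) : psi (Defs.merge a b) != 0 ->
    u1 a = b (exist _ p3 (notin_setC p3S)) /\ u2 a = b (exist _ p4 (notin_setC p4S)).
  by rewrite psiE; case: ifP => [/andP[/eqP -> /eqP ->] //|]; rewrite eqxx.
(* The coordinates at the other parties live in ['I_1]. *)
have sub_eq (B : {set 'I_k}) q1 q2 (q1B : q1 \in B) (q2B : q2 \in B) (a a' : sub_idx d B) :
    (forall i, i \in B -> i \in parties -> i = q1 \/ i = q2) ->
    a (exist _ q1 q1B) = a' (exist _ q1 q1B) :> nat ->
    a (exist _ q2 q2B) = a' (exist _ q2 q2B) :> nat -> a = a'.
  move=> parts e1 e2; apply/ffunP => -[i iB]; apply: val_inj => /=.
  have [iP|iP] := boolP (i \in parties).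
    case: (parts _ iB iP) => ei.
      by subst i; rewrite (bool_irrelevance iB q1B).
    by subst i; rewrite (bool_irrelevance iB q2B).
  move: (a _) (a' _); rewrite /= /four_dim (negPf iP) => z z'.
  by rewrite (ord1 z) (ord1 z').
have partsS i : i \in S -> i \in parties -> i = p1 \/ i = p2.
  move=> iS; rewrite !inE => /or4P[] /eqP e; [by left|by right| |];
    by move: iS; rewrite e ?(negPf p3S) ?(negPf p4S).
have partsSc i : i \in (~: S)%SET -> i \in parties -> i = p3 \/ i = p4.
  rewrite inE => iS; rewrite !inE => /or4P[] /eqP e; [| |by left|by right];
    by move: iS; rewrite e ?p1S ?p2S.
pose m a : C := if (u1 a == 0%N) && (u2 a == 0%N) then w%:R else 1.
have m_ge0 a : 0 <= m a by rewrite /m; case: ifP => _; rewrite ?ler0n ?ler01.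
pose v a := \sum_(b : sub_idx d (~: S)%SET) `|psi (Defs.merge a b)| ^+ 2.
have v_le a : 0 <= v a <= m a ^+ 2.
  rewrite sumr_ge0 => [|b _]; last by rewrite exprn_ge0.
  (* A row of the flattening has at most one nonzero entry. *)
  rewrite /v; case: (pickP (fun b => psi (Defs.merge a b) != 0)) => [b0 pb0|p0]; last first.
    rewrite big1 ?exprn_ge0 // => b _; move/negbFE/eqP: (p0 b) => ->.
    by rewrite normr0 expr0n.
  rewrite (bigD1 b0) //= big1 ?addr0 => [|b bb0].
    rewrite psiE; case: ifP => _; last by rewrite normr0 expr0n exprn_ge0.
    by rewrite -/(m a) ger0_norm.
  have [->|/psi_supp [e1 e2]] := eqVneq (psi (Defs.merge a b)) 0.
    by rewrite normr0 expr0n.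
  case/negP: bb0; apply/eqP; have [f1 f2] := psi_supp _ _ pb0.
  by apply: (sub_eq _ _ _ (notin_setC p3S) (notin_setC p4S) _ _ partsSc); rewrite -?e1 -?e2.
have gramE : flattening S psi *m (flattening S psi)^t* =
    diag_mx (\row_a v (enum_val a)).
  apply/matrixP => a a'; rewrite !mxE.
  have [<-|aa'] := eqVneq a a'.
    rewrite mulr1n /v -(sum_enum_val (fun b => `|psi (Defs.merge _ b)| ^+ 2)).
    by apply: eq_bigr => b _; rewrite !mxE -normCK.
  rewrite mulr0n big1 // => b _; rewrite !mxE.
  have [->|/psi_supp [e1 e2]] := eqVneq (psi (Defs.merge (enum_val a) (enum_val b))) 0.
    by rewrite mul0r.
  have [->|/psi_supp [f1 f2]] := eqVneq (psi (Defs.merge (enum_val a') (enum_val b))) 0.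
    by rewrite conjC0 mulr0.
  case/negP: aa'; apply/eqP/enum_val_inj.
  by apply: (sub_eq S p1 p2 p1S p2S (enum_val a) (enum_val a') partsS);
    [rewrite -/(u1 _) e1 -f1 | rewrite -/(u2 _) e2 -f2].
rewrite gramE det_diag.
apply: (@le_trans _ _ (\prod_(a : sub_idx d S) m a ^+ 2)).
  rewrite [leRHS](reindex _ (onW_bij _ (@enum_val_bij _))) /=.
  by apply: ler_prod => a _; rewrite mxE.
have one_le : 1 <= w%:R ^+ 2 :> C by rewrite exprn_ege1 // ler1n.
case: (pickP (fun a => (u1 a == 0%N) && (u2 a == 0%N))) => [a0 a00|none]; last first.
  by rewrite big1 // => a _; rewrite /m none expr1n.
rewrite (bigD1 a0) //= {1}/m a00 big1 ?mulr1 // => a aa0.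
rewrite /m; case: ifP => [/andP[/eqP e1 /eqP e2]|_]; last by rewrite expr1n.
case/andP: a00 => /eqP f1 /eqP f2; case/negP: aa0; apply/eqP.
by apply: (sub_eq _ _ _ p1S p2S _ _ partsS);
    [rewrite -/(u1 _) e1 -f1 | rewrite -/(u2 _) e2 -f2].
Qed.

End WitnessBounds.

Section LowerBound.
Variables (R : realType) (k : nat) (p1 p2 p3 p4 : 'I_k) (w : nat).
Local Notation C := R[i]%C.
Local Notation parties := [:: p1; p2; p3; p4].
Local Notation d := (four_dim p1 p2 p3 p4).
Local Notation psi := (witness R p1 p2 p3 p4 w).
Hypotheses (w_gt0 : (0 < w)%N) (wE : w%:R = 16 ^+ 2 :> C).
Hypothesis parties_uniq : uniq parties.

Lemma side_entropy_le (S : {set 'I_k}) (phi : tensor R d) :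
  ((p1 \in S) == (p2 \in S)) || ((p3 \in S) == (p4 \in S)) ->
  vn_entropy (density S phi) <= (four_height p1 p2 p3 p4 S)%:R.
Proof.
move=> noncrossing.
have -> : (four_height p1 p2 p3 p4 S)%:R =
    ln (2 ^ four_height p1 p2 p3 p4 S)%:R / ln 2 :> R.
  by rewrite natrX lnXn // -[ln 2 *+ _]mulr_natl mulfK // ln2_neq0.
(* The rank is at most the smaller of the dimensions of the two sides. *)
apply: density_entropy_le; first by rewrite expn_gt0.
rewrite !(card_side parties_uniq) !inE /four_height; move: noncrossing.
by case: (p1 \in S); case: (p2 \in S); case: (p3 \in S); case: (p4 \in S).
Qed.

(** Along the orbit [|psi| ^ 2 >= |delta| w] and the Gram determinant is at most
    [|delta| ^ 4 w ^ 2]; for [w = 16 ^ 2] the quotient of the latter by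
    [|psi| ^ 8] is thus at most [16 ^ -4]. *)
Lemma side_entropy_gap (S : {set 'I_k}) (A : forall i, 'M[C]_(d i)) :
  p1 \in S -> p2 \in S -> p3 \notin S -> p4 \notin S ->
  vn_entropy (density S (tensor_app A psi)) <= gap_bound R.
Proof.
move=> p1S p2S p3S p4S.
pose act i := i \in parties.
have [delta deltaP] : exists delta : 'I_k -> C, forall i x y,
    \sum_u \sum_v A i u x * alt_form C u v * A i v y = delta i * alt_form C x y.
  have [f fP] := boolp.choice (fun i => @alt_form_scale C (act i) (A i)).
  by exists f => i x y; exact: fP.
have cS : #|{: sub_idx d S}| = 4%N.
  by rewrite card_side // p1S p2S (negPf p3S) (negPf p4S).
have cSc : #|{: sub_idx d (~: S)%SET}| = 4%N.
  by rewrite card_side // !inE p1S p2S p3S p4S.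
apply: density_entropy_gap => //.
rewrite (det_gram_tensor_app (act := act) deltaP) //.
have D : `|\prod_i delta i| * w%:R <= sqnorm (tensor_app A psi).
  apply: le_trans (quad_inv_le (b := act) _).
  have -> : quad_inv (b := act) (tensor_app A psi) =
      (\prod_i delta i) * quad_inv (b := act) psi.
    rewrite -(quad_inv_scale (b := act) _ deltaP); congr quad_inv.
    by apply/funext => x; rewrite ffunE.
  rewrite normrM ler_wpM2l //.
  have q_ge : w%:R <= quad_inv (b := act) (C := C) psi by exact: quad_inv_witness.
  by rewrite ger0_norm // (le_trans _ q_ge) // ler0n.
apply: (@le_trans _ _ (`|\prod_i delta i| ^+ 4 * w%:R ^+ 2)).
  by rewrite ler_wpM2l ?exprn_ge0 // det_gram_witness.
have -> : `|\prod_i delta i| ^+ 4 * w%:R ^+ 2 =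
    (`|\prod_i delta i| * w%:R / 16) ^+ 4.
  by rewrite wE; field.
apply: lerXn2r; rewrite ?nnegrE ?divr_ge0 ?mulr_ge0 ?sqnorm_ge0 ?ler0n //.
by apply: ler_wpM2r D; rewrite invr_ge0 ler0n.
Qed.
End LowerBound.

Section Bipartitions.
Variable k : nat.
Implicit Types b c : bipart k.

Lemma val_bipart b : val b = [set side b; ~: side b]%SET /\
  (side b != finset.set0) && (~: side b != finset.set0)%SET.
Proof.
have /existsP[S /and3P[S0 ST /eqP bE]] := valP b.
have := side_in b; rewrite /= in bE *; rewrite bE !inE => /orP[] /eqP ->.
  by split=> //; rewrite S0 -(inj_eq (@finset.setC_inj _)) finset.setCK finset.setC0.
split; first by rewrite finset.setCK finset.setUC.
by rewrite finset.setCK S0 -(inj_eq (@finset.setC_inj _)) finset.setCK finset.setC0 ST.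
Qed.

Lemma nonsingleton_sides b : ~~ singleton_bipart b ->
  (1 < #|side b|)%N /\ (1 < #|(~: side b)%SET|)%N.
Proof.
have [bE /andP[n0 n1]] := val_bipart b; rewrite /singleton_bipart negb_exists.
move/forallP => one; have := one (side b); have := one (~: side b)%SET.
rewrite bE !inE !eqxx orbT /= => c1 c2.
by rewrite 2!(ltn_neqAle 1) !(eq_sym 1%N) c1 c2 !card_gt0 n0 n1.
Qed.

(** Inclusion of a side of [b] in a side of [c] keeps [p1, p2] or [p3, p4]
    together. *)
Lemma laminar_noncrossing b c p1 p2 p3 p4 : laminar b c ->
  p1 \in side b -> p2 \in side b -> p3 \notin side b -> p4 \notin side b ->
  ((p1 \in side c) == (p2 \in side c)) || ((p3 \in side c) == (p4 \in side c)).
Proof.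
have [bE _] := val_bipart b; have [cE _] := val_bipart c.
case/existsP => A /andP[Ab /existsP[B /andP[Bc /fintype.subsetP AB]]] p1b p2b p3b p4b.
move: Ab Bc; rewrite bE cE !inE => /orP[] /eqP eA /orP[] /eqP eB; subst A B.
- by rewrite (AB p1) ?(AB p2).
- have := AB _ p1b; have := AB _ p2b; rewrite !inE.
  by move=> /negPf -> /negPf ->.
- have := AB p3; have := AB p4; rewrite !inE.
  by move=> /(_ p4b) -> /(_ p3b) ->; rewrite orbT.
have := AB p3; have := AB p4; rewrite !inE.
by move=> /(_ p4b) /negPf -> /(_ p3b) /negPf ->; rewrite orbT.
Qed.
End Bipartitions.

(** * Separation of the two functionals *)

Section Separation.
Variables (R : realType) (k : nat) (p1 p2 p3 p4 : 'I_k) (w : nat).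
Local Notation d := (four_dim p1 p2 p3 p4).
Local Notation psi := (witness R p1 p2 p3 p4 w).
Hypotheses (w_gt0 : (0 < w)%N) (wE : w%:R = 16 ^+ 2 :> R[i]%C).
Hypothesis parties_uniq : uniq [:: p1; p2; p3; p4].

(** All the summands are bounded by the dimensions of the flattenings, except the
    one of [b0], where the gap occurs. *)
Lemma E_lower_witness (theta : bipart k -> R) (b0 : bipart k) :
  (forall b, 0 <= theta b) ->
  (forall b, theta b != 0 -> ((p1 \in side b) == (p2 \in side b)) ||
                             ((p3 \in side b) == (p4 \in side b))) ->
  p1 \in side b0 -> p2 \in side b0 -> p3 \notin side b0 -> p4 \notin side b0 ->
  (E_lower theta psi <=
   (\sum_b theta b * (four_height p1 p2 p3 p4 (side b))%:R
    - theta b0 * (2 - gap_bound R))%:E)%E.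
Proof.
move=> theta_ge0 noncrossing p1b p2b p3b p4b; rewrite /E_lower; case: ifP => _.
  exact: leNye.
apply: ge_ereal_sup => _ [A _ <-]; rewrite lee_fin /dist_entropy.
rewrite (bigD1 b0) //= [leRHS](_ : _ =
   theta b0 * gap_bound R +
   \sum_(b | b != b0) theta b * (four_height p1 p2 p3 p4 (side b))%:R); last first.
  rewrite (bigD1 b0) //= {1}/four_height p1b p2b (negPf p3b) (negPf p4b) /=.
  ring.
apply: lerD.
  by apply: ler_wpM2l => //; exact: side_entropy_gap.
apply: ler_sum => b _; have [->|tb] := eqVneq (theta b) 0; first by rewrite !mul0r.
by apply: ler_wpM2l => //; apply: side_entropy_le => //; exact: noncrossing.
Qed.
End Separation.

Local Open Scope classical_set_scope.

Theorem theorem3p1 (R : realType) (k : nat) (theta : bipart k -> R) :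
  (4 <= k)%N ->
  theta \in @lam_dists R k `\` @sing_dists R k ->
  exists (d : 'I_k -> nat) (psi : tensor R d),
    (E_lower theta psi < E_upper theta psi)%E.
Proof.
move=> _; rewrite in_setE => -[[dist lam] notsing].
have [b0 [tb0 nsb0]] : exists b0, theta b0 != 0 /\ ~~ singleton_bipart b0.
  apply: contrapT => none; apply: notsing; split=> // b tb.
  by apply: contrapT => /negP nsb; apply: none; exists b.
have [/card_gt1P[p1 [p2 [p1b p2b n12]]] /card_gt1P[p3 [p4 []]]] :=
  nonsingleton_sides nsb0.
rewrite !inE => p3b p4b n34.
have parties_uniq : uniq [:: p1; p2; p3; p4].
  rewrite /= !inE !negb_or n12 n34 !andbT /=.
  have neq x y : x \in side b0 -> y \notin side b0 -> x != y.
    by move=> xb; apply: contraNneq => <-.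
  by rewrite !neq.
have theta_ge0 := dist.1.
have noncrossing b : theta b != 0 -> ((p1 \in side b) == (p2 \in side b)) ||
                                     ((p3 \in side b) == (p4 \in side b)).
  by move=> tb; apply: laminar_noncrossing (lam _ _ tb0 tb) _ _ _ _.
have [[_ _ n14 n23 _] _] := uniq_parties_neq parties_uniq.
have [w w_gt0 wE] : exists2 w, (0 < w)%N & w%:R = 16 ^+ 2 :> R[i]%C.
  by exists (16 ^ 2)%N; rewrite ?expn_gt0 // natrX.
exists (four_dim p1 p2 p3 p4), (witness R p1 p2 p3 p4 w).
apply: le_lt_trans
  (E_lower_witness w_gt0 wE parties_uniq theta_ge0 noncrossing p1b p2b p3b p4b) _.
apply: lt_le_trans (E_upper_witness w_gt0 n12 n14 n23 n34 noncrossing).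
rewrite lte_fin ltrBlDr ltrDl mulr_gt0 // ?subr_gt0 ?gap_bound_lt2 //.
by rewrite lt_neqAle eq_sym tb0 theta_ge0.
Qed.
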